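(* In the setting of the context, let $\mathcal{C}_h:L^2(\Omega)\to\mathbb{P}^1(\mathcal{T}_h)\cap H^1_0(\Omega)$ be a bounded linear map, and define $\delta_h(u)\in V_h'$ by $\langle\delta_h(u),v_h\rangle_{V_h',V_h}:=a_h(\Pi_hu,v_h)-a(u,\mathcal{C}_h\mathsf{p}(v_h))$ for $v_h\in V_h$. Then for all $m\ge1$, $$\|\lambda_h^m-\lambda\|_{H^{-1}(\Omega)}\le C_\Pi C_{\mathrm{cont}}\|u_h^m-\Pi_hu\|_{V_h}+C_\Pi\|\delta_h(u)\|_{V_h'}+\sup_{v\in H^1_0(\Omega),\,v\ne0}\frac{|a(u,v-\mathcal{C}_hJ_hv)-(f,v-J_hv)|}{\|\nabla v\|_{L^2(\Omega)}}.$$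
   Context: Problem data. $\Omega\subset\mathbb{R}^n$, $n\in\{2,3\}$, is an open bounded Lipschitz domain, $(\cdot,\cdot)$ is the $L^2(\Omega)$ inner product, $f\in L^2(\Omega)$, and $\phi\in H^1(\Omega)\cap C^0(\overline\Omega)$ with $\phi\le 0$ on $\partial\Omega$. $K:=\{v\in H^1_0(\Omega): v\ge\phi\text{ a.e. in }\Omega\}$, $a(w,v):=(\nabla w,\nabla v)$, and $u\in K$ is the unique solution of $a(u,v-u)\ge(f,v-u)$ for all $v\in K$. The multiplier $\lambda\in H^{-1}(\Omega)$ is defined by $\langle\lambda,v\rangle=a(u,v)-(f,v)$ for all $v\in H^1_0(\Omega)$. $H^{-1}(\Omega)$ is the dual of $H^1_0(\Omega)$ with norm $\|\mu\|_{H^{-1}(\Omega)}=\sup_{0\ne v\in H^1_0(\Omega)}\langle\mu,v\rangle/\|\nabla v\|_{L^2(\Omega)}$; an $L^2$ function $\mu$ acts by $\langle\mu,v\rangle=(\mu,v)$. Set $\mathcal{O}:=\{o\in L^2(\Omega): o(x)\in[\phi(x),\infty)\text{ for a.e. }x\}$. Legendre function. $R:\Omega\times\mathbb{R}\to\mathbb{R}\cup\{+\infty\}$ is a Carathéodory function such that for a.e. $x$ the map $R(x,\cdot)$ is a Legendre function with essential domain $[\phi(x),\infty)$ (proper, strictly convex, differentiable on the interior of its essential domain, with gradient singular only at the boundary of the domain) and supercoercive ($R(x,y)/|y|\to\infty$ as $|y|\to\infty$). $R^*(x,z):=\sup_{y\in\mathbb{R}}\{zy-R(x,y)\}$, continuously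 differentiable and strictly convex in $z$; $\nabla\mathcal{R}^*(\psi)(x):=\partial_zR^*(x,\psi(x))$. Standing facts: $\nabla\mathcal{R}^*$ maps $L^\infty(\Omega)$ into $\mathcal{O}$, is continuous on $L^\infty(\Omega)$ and strictly monotone. Mesh and spaces. $\mathcal{T}_h$ is a conforming shape-regular simplicial partition of $\Omega$, with interior facets $\mathcal{F}_h$ and boundary facets $\mathcal{F}_h^\partial$; $h_F$ is the diameter of $F$; $[v]$ is the jump of $v$ across an interior facet and its trace on a boundary facet. $H^1(\mathcal{T}_h)$ is the broken $H^1$-space, $\|v\|_{\mathrm{DG}}^2:=\sum_{T\in\mathcal{T}_h}\|\nabla v\|_{L^2(T)}^2+\sum_{F\in\mathcal{F}_h\cup\mathcal{F}_h^\partial}h_F^{-1}\|[v]\|_{L^2(F)}^2$, and $\mathbb{P}^p(\mathcal{T}_h)$ is the space of functions that are polynomials of degree at most $p$ on each $T$. Abstract discretization. $V_h$ is a finite-dimensional real vector space with norm $\|\cdot\|_{V_h}$ (dual $V_h'$ with dual norm), $W_h:=\mathbb{P}^0(\mathcal{T}_h)$, $V_{\mathcal{T}_h}$ is a space with $\mathbb{P}^0(\mathcal{T}_h)\subseteq V_{\mathcal{T}_h}\subseteq\mathbb{P}^1(\mathcal{T}_h)$, $\mathsf{p}:V_h\to V_{\mathcal{T}_h}$ is linear with $W_h\subseteq\mathsf{p}(V_h)$, and $a_h:V_h\times V_h\to\mathbb{R}$ is a symmetric bilinear form. Assume there are positive constants such that: (i) $a_h(v_h,v_h)\ge C_{\mathrm{coerc}}\|v_h\|_{V_h}^2$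 and $a_h(v_h,z_h)\le C_{\mathrm{cont}}\|v_h\|_{V_h}\|z_h\|_{V_h}$ for all $v_h,z_h\in V_h$; (ii) $\|\mathsf{p}(v_h)\|_{\mathrm{DG}}\le C_{\mathsf{p}}\|v_h\|_{V_h}$ for all $v_h\in V_h$; (iii) there is a linear map $\Pi_h:H^1(\mathcal{T}_h)\to V_h$ such that, with $J_h:=\mathsf{p}\circ\Pi_h$, for all $v\in H^1(\mathcal{T}_h)$: $(J_hv-v,w_h)=0$ for all $w_h\in W_h$, and $\|\Pi_hv\|_{V_h}\le C_\Pi\|v\|_{\mathrm{DG}}$. Iterates. Let $\psi_h^0\in W_h$ and let $(\alpha_k)_{k\ge1}$ be positive reals with $\sum_k\alpha_k=\infty$. For $k\ge1$, $(u_h^k,\psi_h^k)\in V_h\times W_h$ is the unique solution of $a_h(u_h^k,v_h)+\frac1{\alpha_k}(\mathsf{p}(v_h),\psi_h^k-\psi_h^{k-1})=(f,\mathsf{p}(v_h))$ for all $v_h\in V_h$ and $(\mathsf{p}(u_h^k),w_h)=(\nabla\mathcal{R}^*(\psi_h^k),w_h)$ for all $w_h\in W_h$. Set $\lambda_h^k:=(\psi_h^{k-1}-\psi_h^k)/\alpha_k\in W_h\subset L^2(\Omega)$. *)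

(* Defs.v *)
From HB Require Import structures.
From mathcomp Require Import all_boot all_order all_algebra.
From mathcomp Require Import all_classical all_reals all_analysis.
From mathcomp Require Import measurable_realfun.

Set Implicit Arguments.
Unset Strict Implicit.
Unset Printing Implicit Defensive.

Import Order.TTheory GRing.Theory Num.Theory.
Import numFieldNormedType.Exports.

Local Open Scope classical_set_scope.
Local Open Scope ring_scope.

(* ['rV[R]_n] carries the sigma-algebra generated by the coordinates (i.e. the
   Borel one), and the Lebesgue measure [leb n] is the [n]-fold product of the
   one-dimensional Lebesgue measure. *)

Definition rV_display : measure_display.
Proof. exact: (measure_tuple_display default_measure_display). Qed.

Section measurable_rV.
Context {R : realType} (n : nat).

Let coords : 'I_n -> 'rV[R]_n -> measurableTypeR R := fun i x => x ord0 i.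

Let rV_set0 : g_sigma_preimage coords set0.
Proof. exact: sigma_algebra0. Qed.

Let rV_setC A : g_sigma_preimage coords A -> g_sigma_preimage coords (~` A).
Proof. exact: sigma_algebraC. Qed.

Let rV_bigcup (F : (set 'rV[R]_n)^nat) :
  (forall i, g_sigma_preimage coords (F i)) ->
  g_sigma_preimage coords (\bigcup_i (F i)).
Proof. exact: sigma_algebra_bigcup. Qed.

HB.instance Definition _ := @isMeasurable.Build rV_display 'rV[R]_n
  (g_sigma_preimage coords) rV_set0 rV_setC rV_bigcup.

Lemma measurable_rV_coord (i : 'I_n) :
  measurable_fun [set: 'rV[R]_n] (fun x => x ord0 i : measurableTypeR R).
Proof.
move=> _ Y mY; rewrite setTI; apply: sub_sigma_algebra => /=.
rewrite -bigcup_seq/=; exists i => /=; first by rewrite mem_index_enum.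
by exists Y => //; rewrite setTI.
Qed.

Lemma measurable_fun_rVP d (T : measurableType d) (f : T -> 'rV[R]_n) :
  (forall i, measurable_fun setT (fun t => f t ord0 i : measurableTypeR R)) ->
  measurable_fun [set: T] f.
Proof.
move=> mf _ A; rewrite setTI => mA.
have : g_sigma_preimage (fun i => coords i \o f) `<=` measurable.
  apply: smallest_sub; first exact: sigma_algebra_measurable.
  rewrite -bigcup_seq; apply: bigcup_sub => i _ B [C mC <-].
  exact: mf.
apply; rewrite g_sigma_preimage_comp; exists A => //.
by rewrite setTI.
Qed.

End measurable_rV.

Section lebesgue_rV.
Context {R : realType}.

Definition cons_rV n (p : measurableTypeR R * 'rV[R]_n) : 'rV[R]_n.+1 :=
  \row_i (if unlift ord0 i is Some j then p.2 ord0 j else p.1).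

Definition uncons_rV n (x : 'rV[R]_n.+1) : measurableTypeR R * 'rV[R]_n :=
  (x ord0 ord0, \row_j x ord0 (lift ord0 j)).

Lemma cons_rVK n : cancel (@cons_rV n) (@uncons_rV n).
Proof.
case=> a v; rewrite /uncons_rV /cons_rV mxE unlift_none; congr pair.
by apply/rowP => j; rewrite !mxE liftK.
Qed.

Lemma measurable_cons_rV n : measurable_fun setT (@cons_rV n).
Proof.
apply: measurable_fun_rVP => i; case: (unliftP ord0 i) => [j ->|->].
- rewrite (_ : (fun _ => _) = (fun x : 'rV[R]_n => x ord0 j) \o snd).
    exact: (measurableT_comp (measurable_rV_coord j)).
  by apply/funext => p; rewrite /= mxE liftK.
- rewrite (_ : (fun _ => _) = fst); first exact: measurable_fst.
  by apply/funext => p; rewrite mxE unlift_none.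
Qed.

Lemma measurable_uncons_rV n : measurable_fun setT (@uncons_rV n).
Proof.
apply/measurable_fun_pairP; split; first exact: measurable_rV_coord.
apply: measurable_fun_rVP => i.
rewrite (_ : (fun _ => _) = fun x : 'rV[R]_n.+1 => x ord0 (lift ord0 i)).
  exact: measurable_rV_coord.
by apply/funext => p; rewrite mxE.
Qed.

Section leb_cons.
Variables (n : nat) (m : {sigma_finite_measure set 'rV[R]_n -> \bar R}).

Definition leb_cons : set 'rV[R]_n.+1 -> \bar R :=
  pushforward (@lebesgue_measure R \x m)%E (@cons_rV n).

Let pre_meas A : measurable A -> measurable (@cons_rV n @^-1` A).
Proof.
by move=> mA; rewrite -[X in measurable X]setTI; exact: measurable_cons_rV.
Qed.

Let leb_cons0 : leb_cons set0 = 0%E.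
Proof. by rewrite /leb_cons /pushforward preimage_set0 measure0. Qed.

Let leb_cons_ge0 A : (0 <= leb_cons A)%E.
Proof. by rewrite /leb_cons /pushforward; exact: measure_ge0. Qed.

Let leb_cons_sigma_additive : semi_sigma_additive leb_cons.
Proof.
move=> F mF tF mUF; rewrite /leb_cons /pushforward preimage_bigcup.
apply: measure_semi_sigma_additive.
- by move=> k; exact: pre_meas.
- apply/trivIsetP => /= i j _ _ ij; rewrite -preimage_setI.
  by move/trivIsetP : tF => /(_ _ _ _ _ ij) ->//; rewrite preimage_set0.
- by rewrite -preimage_bigcup; exact: pre_meas.
Qed.

HB.instance Definition _ := isMeasure.Build _ _ _ leb_cons
  leb_cons0 leb_cons_ge0 leb_cons_sigma_additive.

Let leb_cons_sigma_finite : sigma_finite setT leb_cons.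
Proof.
have /sigma_finiteP[F [TF ndF Foo]] := sigma_finiteT (@lebesgue_measure R).
have /sigma_finiteP[G [TG ndG Goo]] := sigma_finiteT m.
exists (fun k => @uncons_rV n @^-1` (F k `*` G k)).
  apply/esym/seteqP; split => // x _.
  have [i _ Fi] : (\bigcup_i F i) (x ord0 ord0) by rewrite -TF.
  have [j _ Gj] : (\bigcup_i G i) (\row_j x ord0 (lift ord0 j)) by rewrite -TG.
  exists (maxn i j) => //; split => /=.
  - by move: Fi; exact/subsetPset/ndF/leq_maxl.
  - by move: Gj; exact/subsetPset/ndG/leq_maxr.
move=> k; have [mF ?] := Foo k; have [mG ?] := Goo k; split.
  rewrite -[X in measurable X]setTI; apply: measurable_uncons_rV => //.
  exact: measurableX.
rewrite /leb_cons /pushforward -comp_preimage.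
rewrite (_ : _ \o _ = id); last by apply/funext => x /=; rewrite cons_rVK.
by rewrite preimage_id product_measure1E// lte_mul_pinfty// ge0_fin_numE.
Qed.

HB.instance Definition _ :=
  Measure_isSigmaFinite.Build _ _ _ leb_cons leb_cons_sigma_finite.

End leb_cons.

Fixpoint leb n : {sigma_finite_measure set 'rV[R]_n -> \bar R} :=
  match n with
  | 0 => \d_(0 : 'rV[R]_0)
  | n'.+1 => leb_cons (leb n')
  end.

End lebesgue_rV.

(* Elements of function spaces on [D] are functions on the whole of
   ['rV[R]_n]; only their values on [D] matter, and only up to null sets.

   A Sobolev function is represented by the pair of the function and its weak
   gradient; as the latter is unique up to a null set, this is the usual
   identification of H^1 with a closed subspace of L2 * L2^n. *)
Notation sobolev R n := (('rV[R]_n -> R) * ('rV[R]_n -> 'rV[R]_n))%type.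

Section sobolev.
Context {R : realType} {n : nat}.
Local Notation E := 'rV[R]_n.
Implicit Types (D : set E) (f g : E -> R).

Definition dotv (x y : E) : R := \sum_i x ord0 i * y ord0 i.

Definition enorm (x : E) : R := Num.sqrt (dotv x x).

Definition ae_on D (P : E -> Prop) : Prop :=
  {ae leb n, forall x, D x -> P x}.

Definition L2 D f : Prop :=
  measurable_fun D f /\ (\int[leb n]_(x in D) (f x ^+ 2)%:E < +oo)%E.

Definition Linfty D f : Prop :=
  measurable_fun D f /\ exists M : R, ae_on D (fun x => `|f x| <= M).

Definition l2dot D f g : R := \int[leb n]_(x in D) (f x * g x).

Definition l2norm D f : R := Num.sqrt (l2dot D f f).

Definition iter_partial (s : seq 'I_n) f : E -> R :=
  foldr (fun i h => 'D_('e_i) h) f s.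

Definition smooth f : Prop :=
  forall s : seq 'I_n, continuous (iter_partial s f) /\
    forall (i : 'I_n) (x : E), derivable (iter_partial s f) x 'e_i.

Definition test_function D f : Prop :=
  smooth f /\
  exists K : set E, [/\ compact K, K `<=` D & forall x, ~ K x -> f x = 0].

Definition grad f (x : E) : E := \row_i 'D_('e_i) f x.

Implicit Types v w : sobolev R n.

Definition is_weak_gradient D f (g : E -> E) : Prop :=
  forall phi : E -> R, test_function D phi -> forall i : 'I_n,
    l2dot D f ('D_('e_i) phi) = - l2dot D (fun x => g x ord0 i) phi.

Definition H1 D v : Prop :=
  [/\ L2 D v.1, forall i : 'I_n, L2 D (fun x => v.2 x ord0 i)
    & is_weak_gradient D v.1 v.2].

Definition dirichlet D v w : R := \int[leb n]_(x in D) dotv (v.2 x) (w.2 x).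

Definition h1semi D v : R := Num.sqrt (dirichlet D v v).

Definition h1norm D v : R := Num.sqrt (l2dot D v.1 v.1 + dirichlet D v v).

Definition sob_of_smooth f : sobolev R n := (f, grad f).

Definition H10 D v : Prop :=
  H1 D v /\
  exists phi : nat -> E -> R, (forall k, test_function D (phi k)) /\
    h1norm D (sob_of_smooth (phi k) - v) @[k --> \oo] --> (0 : R).

Definition sob_eq D v w : Prop :=
  ae_on D (fun x => v.1 x = w.1 x /\ v.2 x = w.2 x).

Definition H10_nonzero D v : Prop :=
  H10 D v /\ ~ ae_on D (fun x => v.1 x = 0).

Definition hm1norm D (ell : sobolev R n -> R) : \bar R :=
  ereal_sup [set (ell v / h1semi D v)%:E | v in [set v | H10_nonzero D v]].

End sobolev.

Definition frontier {T : topologicalType} (D : set T) : set T :=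
  closure D `\` interior D.

(* Near each boundary point, in suitable Cartesian coordinates (given by the
   orthogonal matrix [Q]), [D] is the strict epigraph of a Lipschitz function of
   the first [n] coordinates. *)
Definition lipschitz_boundary {R : realType} {n : nat}
    (D : set 'rV[R]_n.+1) : Prop :=
  forall x, frontier D x ->
  exists (Q : 'M[R]_n.+1) (gamma : 'rV[R]_n -> R) (r L : R),
    [/\ Q *m Q^T = 1%:M, 0 < r,
        forall s t, `|gamma s - gamma t| <= L * enorm (s - t)
      & forall y, enorm (y - x) < r ->
          (D y <-> gamma (col' ord_max (y *m Q)) < (y *m Q) ord0 ord_max)].

Section obstacle.
Context {R : realType} {n : nat}.
Local Notation E := 'rV[R]_n.
Variables (D : set E) (phi f : E -> R).

Definition admissible_set (v : sobolev R n) : Prop :=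
  H10 D v /\ ae_on D (fun x => phi x <= v.1 x).

Definition obstacle_solution (u : sobolev R n) : Prop :=
  admissible_set u /\
  forall v, admissible_set v ->
    l2dot D f (v - u).1 <= dirichlet D u (v - u).

Definition multiplier (u v : sobolev R n) : R :=
  dirichlet D u v - l2dot D f v.1.

Definition above_obstacle (o : E -> R) : Prop :=
  L2 D o /\ ae_on D (fun x => phi x <= o x).

End obstacle.

Section legendre.
Context {R : realType}.

(* The essential domain is [a, +oo[; the last clause says that the derivative
   is singular at its boundary point [a]. *)
Definition legendre (a : R) (r : R -> \bar R) : Prop :=
  [/\ forall y, r y != -oo%E,
      forall y, (r y < +oo)%E <-> a <= y,
      forall y z t, a <= y -> a <= z -> y != z -> 0 < t < 1 ->
        (r (t * y + (1 - t) * z)%R < t%:E * r y + (1 - t)%:E * r z)%E,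
      forall y, a < y -> derivable (fine \o r : R -> R) y 1
    & `|derive1 (fine \o r : R -> R) y| @[y --> a^'+] --> +oo].

Definition supercoercive (r : R -> \bar R) : Prop :=
  forall A : R, exists B : R, forall y, B < `|y| -> ((A * `|y|)%:E <= r y)%E.

Definition conjugate (r : R -> \bar R) (z : R) : \bar R :=
  ereal_sup (range (fun y : R => (z * y)%:E - r y)%E).

Definition C1_strictly_convex (r : R -> \bar R) : Prop :=
  [/\ forall z, r z \is a fin_num,
      forall z, derivable (fine \o r : R -> R) z 1,
      continuous (derive1 (fine \o r : R -> R))
    & forall y z t, y != z -> 0 < t < 1 ->
        (r (t * y + (1 - t) * z)%R < t%:E * r y + (1 - t)%:E * r z)%E].

Context {n : nat}.
Local Notation E := 'rV[R]_n.
Variables (D : set E) (phi : E -> R) (Leg : E -> R -> \bar R).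

(* Continuity in the second variable is that of the restriction to the
   essential domain: [Leg x] jumps to [+oo] at [phi x] when finite there. *)
Definition caratheodory : Prop :=
  (forall y, measurable_fun D (Leg^~ y)) /\
  ae_on D (fun x =>
    {within `[phi x, +oo[, continuous (fine \o Leg x : R -> R)}).

Definition legendre_integrand : Prop :=
  caratheodory /\
  ae_on D (fun x => legendre (phi x) (Leg x) /\ supercoercive (Leg x)).

Definition grad_conjugate (psi : E -> R) (x : E) : R :=
  derive1 (fine \o conjugate (Leg x) : R -> R) (psi x).

(* The third clause is continuity from Linfty to L2. *)
Definition conjugate_facts : Prop :=
  [/\ ae_on D (fun x => C1_strictly_convex (conjugate (Leg x))),
      forall psi, Linfty D psi -> above_obstacle D phi (grad_conjugate psi),
      forall psi, Linfty D psi -> forall eps : R, 0 < eps ->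
        exists2 eta : R, 0 < eta & forall psi', Linfty D psi' ->
          ae_on D (fun x => `|psi' x - psi x| <= eta) ->
          l2norm D (grad_conjugate psi' - grad_conjugate psi) <= eps
    & forall psi psi', Linfty D psi -> Linfty D psi' ->
        ~ ae_on D (fun x => psi x = psi' x) ->
        0 < l2dot D (grad_conjugate psi - grad_conjugate psi') (psi - psi')].

End legendre.

(* A mesh of a domain of dimension [n.+1]; cells and facets are identified with
   their sets of vertices. *)
Record mesh (R : realType) (n : nat) := Mesh {
  vertex : finType;
  pos : vertex -> 'rV[R]_n.+1;
  cells : {set {set vertex}} }.

Section mesh.
Context {R : realType} {n : nat} (M : mesh R n).
Local Notation E := 'rV[R]_n.+1.
Local Notation vert := (vertex M).
Implicit Types (S T F : {set vert}).

Definition simplex S : set E := [set x | exists w : vert -> R,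
  [/\ forall i, i \in S -> 0 <= w i, \sum_(i in S) w i = 1
    & x = \sum_(i in S) w i *: pos i]].

Definition open_simplex S : set E := [set x | exists w : vert -> R,
  [/\ forall i, i \in S -> 0 < w i, \sum_(i in S) w i = 1
    & x = \sum_(i in S) w i *: pos i]].

Definition affinely_independent S : Prop := forall w : vert -> R,
  \sum_(i in S) w i = 0 -> \sum_(i in S) w i *: pos i = 0 ->
  forall i, i \in S -> w i = 0.

Definition diam (A : set E) : R :=
  sup [set d | exists x y, [/\ A x, A y & d = enorm (x - y)]].

(* Conforming simplicial partition of [D], shape regular with constant
   [sigma]: each cell contains a ball whose radius is at least its diameter
   divided by [sigma]. *)
Definition triangulation (D : set E) (sigma : R) : Prop :=
  [/\ forall T, T \in cells M -> #|T| = n.+2 /\ affinely_independent T,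
      forall T T', T \in cells M -> T' \in cells M ->
        simplex T `&` simplex T' = simplex (T :&: T'),
      closure D = [set x | exists2 T, T \in cells M & simplex T x],
      forall T, T \in cells M -> open_simplex T `<=` D
    & forall T, T \in cells M -> exists (c : E) (r : R),
        [/\ 0 < r, [set x | enorm (x - c) < r] `<=` simplex T
          & diam (simplex T) <= sigma * r]].

Definition cells_at F : {set {set vert}} := [set T in cells M | F \subset T]%SET.

Definition interior_facets : {set {set vert}} :=
  [set F : {set vert} | (#|F| == n.+1) && (#|cells_at F| == 2%N)]%SET.

Definition boundary_facets : {set {set vert}} :=
  [set F : {set vert} | (#|F| == n.+1) && (#|cells_at F| == 1%N)]%SET.

(* Surface integrals are computed in the affine chart mapping the reference
   simplex of dimension [n] onto the facet, with the square root of the Gram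
   determinant as area density. *)
Definition ref_simplex : set 'rV[R]_n :=
  [set t | (forall i, 0 <= t ord0 i) /\ \sum_i t ord0 i <= 1].

Definition facet_vertex F (k : nat) : E := nth 0 [seq pos i | i <- enum F] k.

Definition facet_edges F : 'M[R]_(n, n.+1) :=
  \matrix_(i < n) (facet_vertex F i.+1 - facet_vertex F 0).

Definition facet_chart F (t : 'rV[R]_n) : E :=
  facet_vertex F 0 + t *m facet_edges F.

Definition facet_integral F (g : E -> R) : R :=
  Num.sqrt (\det (facet_edges F *m (facet_edges F)^T)) *
  \int[leb n]_(t in ref_simplex) g (facet_chart F t).

Definition L2_facet F (g : E -> R) : Prop :=
  measurable_fun ref_simplex (g \o facet_chart F) /\
  (\int[leb n]_(t in ref_simplex) (g (facet_chart F t) ^+ 2)%:E < +oo)%E.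

(* [g] is the trace on [F] of [v] in H^1(T): the L2(F) limit of the
   restrictions to [F] of smooth functions converging to [v] in H^1(T). *)
Definition is_trace T F (v : sobolev R n.+1) (g : E -> R) : Prop :=
  L2_facet F g /\
  exists phi : nat -> E -> R,
    [/\ forall k, smooth (phi k),
        h1norm (open_simplex T) (sob_of_smooth (phi k) - v) @[k --> \oo]
          --> (0 : R)
      & facet_integral F (fun x => (phi k x - g x) ^+ 2) @[k --> \oo]
          --> (0 : R)].

Definition trace T F (v : sobolev R n.+1) : E -> R :=
  xget (fun=> 0) [set g | is_trace T F v g].

(* The sign of the jump across an interior facet is irrelevant below. *)
Definition jump F (v : sobolev R n.+1) (x : E) : R :=
  match enum (cells_at F) with
  | [:: T] => trace T F v x
  | [:: T1; T2] => trace T1 F v x - trace T2 F v x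
  | _ => 0
  end.

Definition broken_H1 (D : set E) (v : sobolev R n.+1) : Prop :=
  L2 D v.1 /\ forall T, T \in cells M -> H1 (open_simplex T) v.

Definition dgnorm (v : sobolev R n.+1) : R := Num.sqrt (
  \sum_(T in cells M) h1semi (open_simplex T) v ^+ 2 +
  \sum_(F in interior_facets :|: boundary_facets)
    (diam (simplex F))^-1 * facet_integral F (fun x => jump F v x ^+ 2)).

Definition is_poly (p : nat) (q : E -> R) : Prop :=
  exists c : {ffun 'I_n.+1 -> 'I_p.+1} -> R, forall x,
    q x = \sum_(m : {ffun 'I_n.+1 -> 'I_p.+1} | (\sum_i m i <= p)%N)
            c m * \prod_i x ord0 i ^+ m i.

Definition pwpoly (D : set E) (p : nat) : set (E -> R) :=
  [set v | L2 D v /\ forall T, T \in cells M ->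
     exists2 q, is_poly p q & ae_on (open_simplex T) (fun x => v x = q x)].

End mesh.

Section discretization.
Context {R : realType} {n : nat}.
Local Notation E := 'rV[R]_n.+1.

Definition finite_dimensional (V : lmodType R) : Prop :=
  exists (d : nat) (b : 'I_d -> V),
    forall v, exists c : 'I_d -> R, v = \sum_i c i *: b i.

Definition dual_norm (V : normedModType R) (ell : V -> R) : \bar R :=
  ereal_sup [set `|ell v|%:E | v in [set v | `|v| <= 1]].

Definition symmetric_bilinear (V : lmodType R) (b : V -> V -> R) : Prop :=
  (forall c x y z, b (c *: x + y) z = c * b x z + b y z) /\
  (forall x y, b x y = b y x).

Definition subspace_of_functions (S : set (E -> R)) : Prop :=
  S (fun=> 0) /\ forall c v w, S v -> S w -> S (fun x => c * v x + w x).

(* The target is finite dimensional, so that boundedness does not depend on its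
   norm; the norm of H^1_0 is used. *)
Definition bounded_linear_to_P1_H10 (M : mesh R n) (D : set E)
    (C : (E -> R) -> sobolev R n.+1) : Prop :=
  [/\ forall g, L2 D g -> H10 D (C g) /\ pwpoly M D 1 (C g).1,
      forall c g g', L2 D g -> L2 D g' ->
        sob_eq D (C (fun x => c * g x + g' x)) (c *: C g + C g')
    & exists B : R, forall g, L2 D g -> h1semi D (C g) <= B * l2norm D g].

End discretization.

(* Main.v *)
(* Orthogonality of [p \o Pi] to piecewise constants and the primal equation turn
   [<lambda_h^m - lambda, v>] into
     a_h(u_h^m - Pi u, Pi v) + <delta_h(u), Pi v>
       - (a(u, v - C_h J_h v) - (f, v - J_h v)),
   and it remains to see that [|Pi v| <= C_Pi |v|_DG <= C_Pi |grad v|].  The last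
   inequality says that the jumps of [v] in H^1_0 vanish.  For this, let [chi_k]
   be test functions converging to [v] in H^1.  If smooth [phi_k] converge to [v]
   in H^1(T) and have traces converging to [g] in L^2(F), then by the trace
   inequality on [T] the traces of [chi_k] converge to [g] as well: the traces of
   [v] from the two sides of [F] are characterised by the same [chi_k], hence
   agree.  If [F] is a boundary facet, the [chi_k] vanish on it.

   The trace inequality follows from the one-dimensional one along segments going
   from [F] into [T], by Tonelli and an affine change of variables. *)

Require Import Defs.
From mathcomp Require Import all_boot all_order all_algebra.
From mathcomp Require Import all_classical all_reals all_analysis.
From mathcomp Require Import measurable_realfun lra ring.

Set Implicit Arguments.
Unset Strict Implicit.
Unset Printing Implicit Defensive.

Import Order.TTheory GRing.Theory Num.Theory.
Import numFieldNormedType.Exports.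

Local Open Scope classical_set_scope.
Local Open Scope ring_scope.

(** * Lebesgue measure on row vectors *)

Section lebesgue_measure_rV.
Context {R : realType}.

(** A trace is picked by [xget] from the set of all admissible limits, a set that might a priori be
    empty. The sets seen from the two cells at a facet are therefore compared as sets: once they are
    equal, the two picks are literally the same function, default value included. On a boundary
    facet every element of the set has zero norm, and the default is zero as well.

    No single direction leads from all of a facet F into its cell T: the barycentric weights of a
    direction sum to zero, so if the weight at the vertex off F grows, some weight on F drops, and
    the segment leaves T at once where this weight is already zero. Hence one direction per vertex
    of F: every point of F has some barycentric coordinate at least 1/(n+1), and the direction
    attached to that vertex serves it.

    [p] and [Ch] are linear only up to null sets, yet [Ch] takes actual functions as arguments. Its
    boundedness in L2 is what makes the form a(u, Ch g) depend on the class of g alone. *)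

Lemma measurable_box m (P : 'I_m -> set R) : (forall i, measurable (P i)) ->
  measurable [set y : 'rV[R]_m | forall i, P i (y ord0 i)].
Proof.
move=> mP.
rewrite (_ : [set _ | _] =
  \bigcap_(i in setT) [set y : 'rV[R]_m | P i (y ord0 i)]); last first.
  by apply/seteqP; split => y /= yP i => [_|]; exact: yP.
apply: fin_bigcap_measurable; first exact: finite_finset.
move=> i _; have := measurable_rV_coord i measurableT (mP i).
by rewrite setTI.
Qed.

(** The sigma-algebra is generated by the coordinates, so an open set has to be written as a
    countable union of boxes; those with rational centre and radius 1/(k+1) suffice. *)
Lemma open_measurable_rV m (A : set 'rV[R]_m) : open A -> measurable A.
Proof.
move=> oA.
pose box (c : 'rV[R]_m) (r : R) :=
  [set y : 'rV[R]_m | forall i,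
    `](c ord0 i - r), (c ord0 i + r)[%classic (y ord0 i)].
pose U (qk : 'rV[rat]_m * nat) : set 'rV[R]_m :=
  if `[< box (map_mx ratr qk.1) qk.2.+1%:R^-1 `<=` A >]
  then box (map_mx ratr qk.1) qk.2.+1%:R^-1 else set0.
suff -> : A = \bigcup_i U i.
  apply: countable_bigcupT_measurable; first exact: countableP.
  move=> i; rewrite /U; case: asboolP => // _.
  pose P j := `](map_mx ratr i.1 : 'rV[R]_m) ord0 j - i.2.+1%:R^-1,
    (map_mx ratr i.1 : 'rV[R]_m) ord0 j + i.2.+1%:R^-1[%classic.
  apply: (@measurable_box m P) => j.
  exact: measurable_itv.
apply/seteqP; split => [x Ax|x [i _]]; last first.
  by rewrite /U; case: asboolP => // + ?; apply.
have [e /= e0 eA] := open_subball oA Ax.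
(* A box of radius r whose centre is within r of x stays within 2 r of x, and r < e / 4 makes this
   less than e / 2. *)
have [k ke] : exists k, k.+1%:R^-1 < e / 4.
  have e4 : 0 < e / 4 by rewrite divr_gt0.
  by have [k] := ltr_add_invr e4; rewrite add0r => ?; exists k.
pose r : R := k.+1%:R^-1.
have r0 : 0 < r by rewrite invr_gt0.
have q_ i : {q : rat | x ord0 i - r < ratr q < x ord0 i + r}.
  apply/cid; have [||y [/= yx [q _ qy]]] :=
    @dense_rat R `](x ord0 i - r), (x ord0 i + r)[%classic.
  - by exists (x ord0 i); rewrite /= in_itv/= ltrBlDr ltrDl r0.
  - exact: interval_open.
  by exists q; rewrite qy; move: yx; rewrite in_itv.
exists (\row_i sval (q_ i), k) => //; rewrite /U/=.
case: asboolP => [_ i|].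
  rewrite /= !mxE in_itv/= -/r; case: (q_ i) => q /= /andP[h1 h2].
  by apply/andP; split; lra.
case=> y By; apply: (eA (e / 2)).
- by rewrite /= sub0r normrN gtr0_norm ?divr_gt0//; lra.
- by rewrite divr_gt0.
split; first by rewrite divr_gt0.
move=> i' i; rewrite (ord1 i') /ball/=.
have := By i; rewrite /= !mxE in_itv/= -/r;
  case: (q_ i) => q /= /andP[h1 h2] /andP[h3 h4].
have := ke; rewrite -/r => ke'.
by rewrite ltr_norml; apply/andP; split; lra.
Qed.

Lemma continuous_measurable_rV m (g : 'rV[R]_m -> R) : continuous g ->
  measurable_fun [set: 'rV[R]_m] g.
Proof.
move=> /continuousP cg.
apply: (measurability _ (RGenOpens.measurableE R)) => _ [_ [a [b ->]] <-].
by rewrite setTI; apply: open_measurable_rV; exact/cg/interval_open.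
Qed.

Lemma continuous_measurable_rV_rV m l (g : 'rV[R]_m -> 'rV[R]_l) :
  continuous g -> measurable_fun [set: 'rV[R]_m] g.
Proof.
move=> cg; apply: measurable_fun_rVP => i.
apply: (@continuous_measurable_rV m (fun t => g t ord0 i)) => x.
apply: (continuous_comp (f := g) (g := fun M : 'rV[R]_l => M ord0 i)).
  exact: cg.
exact: coord_continuous.
Qed.


Lemma integral_leb_cons n (g : 'rV[R]_n.+1 -> \bar R) :
  measurable_fun setT g -> (forall x, (0 <= g x)%E) ->
  (\int[leb n.+1]_x g x =
   \int[leb n]_t \int[lebesgue_measure]_s g (cons_rV (s, t)))%E.
Proof.
move=> mg g0.
have mgc : measurable_fun setT (g \o @cons_rV R n).
  exact: (measurableT_comp mg (@measurable_cons_rV R n)).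
rewrite [LHS](ge0_integral_pushforward (@measurable_cons_rV R n))//.
rewrite preimage_setT.
have := @fubini_tonelli2 _ _ _ _ R lebesgue_measure (leb n) (g \o @cons_rV R n)
  mgc (fun x => g0 _).
exact.
Qed.

(** The image of Lebesgue measure under a translation agrees with it on half-open intervals, hence
    everywhere by uniqueness. *)
Lemma ge0_integral_shift (g : R -> \bar R) (a : R) :
  measurable_fun setT g -> (forall x, (0 <= g x)%E) ->
  (\int[lebesgue_measure]_s g (s + a)%R = \int[lebesgue_measure]_s g s)%E.
Proof.
move=> mg g0.
pose sh : measurableTypeR R -> measurableTypeR R := fun s => s + a.
have msh : measurable_fun setT sh by exact: measurable_funD.
transitivity (\int[pushforward lebesgue_measure sh]_s g s)%E.
  by rewrite [RHS](ge0_integral_pushforward msh).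
apply: eq_measure_integral => A mA _.
apply/esym/(@lebesgue_measure_unique _ (pushforward lebesgue_measure sh)) => //
  _ [[c d]] _ <-.
rewrite /= /pushforward.
rewrite (_ : sh @^-1` _ = `]c - a, d - a]%classic); last first.
  by apply/seteqP; split => x /=; rewrite /sh !in_itv/= ltrBlDr lerBrDr.
by rewrite !lebesgue_measure_itv/= !lte_fin ltrD2r -!EFinB;
  congr (if _ then _ else _); congr EFin; ring.
Qed.

Lemma continuous_addr_rV m (a : 'rV[R]_m) :
  continuous (fun x : 'rV[R]_m => x + a).
Proof. move=> x; apply: (@continuousD _ _ _ id (cst a)); first exact: cvg_id.
exact: cst_continuous. Qed.

(** Tonelli splits off the first coordinate: the inner integral absorbs the first component of [a],
    the induction hypothesis the others. *)
Lemma ge0_integral_leb_shift n (g : 'rV[R]_n -> \bar R) (a : 'rV[R]_n) :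
  measurable_fun setT g -> (forall x, (0 <= g x)%E) ->
  (\int[leb n]_x g (x + a)%R = \int[leb n]_x g x)%E.
Proof.
elim: n g a => [|n ih] g a mg g0.
  by apply: eq_integral => x _; rewrite (_ : x + a = x)//; apply/rowP => -[].
have msh (m : nat) (b : 'rV[R]_m) :
  measurable_fun setT (fun x : 'rV[R]_m => x + b).
  by apply: continuous_measurable_rV_rV; exact: continuous_addr_rV.
have mga : measurable_fun setT (fun x : 'rV[R]_n.+1 => g (x + a))
  by exact: (measurableT_comp mg (msh _ a)).
rewrite !integral_leb_cons//.
pose a0 := a ord0 ord0; pose a' : 'rV[R]_n := \row_j a ord0 (lift ord0 j).
pose G : 'rV[R]_n -> \bar R :=
  fun t => (\int[lebesgue_measure]_s g (cons_rV (s, t)))%E.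
transitivity (\int[leb n]_t G (t + a')%R)%E; last first.
  apply: ih => [|t]; last exact: integral_ge0.
  apply: (measurable_fun_fubini_tonelli_G (m1 := lebesgue_measure)
    (g \o @cons_rV R n)) => //.
    exact: (measurableT_comp mg (@measurable_cons_rV R n)).
  by move=> x; exact: g0.
apply: eq_integral => t _.
rewrite /G -(@ge0_integral_shift (fun s => g (cons_rV (s, t + a'))) a0)//.
  apply: eq_integral => s _; congr g; apply/rowP => i; rewrite !mxE.
  by case: (unliftP ord0 i) => [j ->|->]; rewrite /= ?mxE.
apply: (measurableT_comp mg);
  apply: (measurableT_comp (@measurable_cons_rV R n)).
exact: measurable_pair2.
Qed.

Definition cube n (c : R) : set 'rV[R]_n :=
  [set y : 'rV[R]_n | forall i, `[- c, c]%classic (y ord0 i)].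

Lemma measurable_cube n c : measurable (@cube n c).
Proof. by apply: (@measurable_box _ (fun=> `[- c, c]%classic)). Qed.

Lemma leb_cube n (c : R) : 0 <= c -> leb n (@cube n c) = ((2 * c) ^+ n)%:E.
Proof.
move=> c0.
have lc : lebesgue_measure (`[- c, c]%classic : set R) = (2 * c)%:E.
  rewrite lebesgue_measure_itv/= lte_fin; case: ltP => cc.
    by rewrite -EFinB; congr EFin; ring.
  by congr EFin; lra.
elim: n => [|n ih]; first by rewrite /= /dirac/= indicE mem_set// => -[].
rewrite /= /leb_cons /pushforward.
rewrite (_ : _ @^-1` _ = `[- c, c]%classic `*` @cube n c); last first.
  apply/seteqP; split => -[s t] /=.
    move=> st; split.
      by have := st ord0; rewrite /cons_rV mxE unlift_none.
    by move=> i; have := st (lift ord0 i); rewrite /cons_rV mxE liftK.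
  move=> [sc tc] i; rewrite /cons_rV mxE.
  by case: unliftP => [j _|_]; [exact: tc|].
rewrite product_measure1E//; last exact: measurable_cube.
rewrite [X in (_ * X)%E]ih.
rewrite [X in (X * _)%E]lc -EFinM exprS//.
Qed.


Lemma continuous_rV (T : topologicalType) l (g : T -> 'rV[R]_l) :
  (forall i, continuous (fun t => g t ord0 i)) -> continuous g.
Proof.
move=> cg x; apply/cvg_ballP => e e0.
near=> y; split => // i' j; rewrite (ord1 i') {i'}.
move: j; near: y; apply: filter_forall => j.
exact: (cvg_ball (cg j x)).
Unshelve. all: by end_near.
Qed.

Lemma continuous_sum_fun (T : topologicalType) (I : Type) (s : seq I)
  (F : I -> T -> R) :
  (forall i, continuous (F i)) -> continuous (fun x => \sum_(i <- s) F i x).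
Proof.
move=> cF x; elim: s => [|i s ih].
  by under eq_fun do rewrite big_nil; exact: cst_continuous.
by under eq_fun do rewrite big_cons; apply: continuousD; [exact: cF|exact: ih].
Qed.

Lemma continuous_mulf (T : topologicalType) (f g : T -> R) :
  continuous f -> continuous g -> continuous (fun x => f x * g x).
Proof. by move=> cf cg x; apply: cvgM; [exact: cf|exact: cg]. Qed.

Lemma continuous_addf (T : topologicalType) (f g : T -> R) :
  continuous f -> continuous g -> continuous (fun x => f x + g x).
Proof. by move=> cf cg x; apply: cvgD; [exact: cf|exact: cg]. Qed.

Lemma continuous_sqrf (T : topologicalType) (f : T -> R) :
  continuous f -> continuous (fun x => f x ^+ 2).
Proof. by move=> cf; exact: continuous_mulf. Qed.

Lemma continuous_mulmx_rV m l (A : 'M[R]_(m, l)) :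
  continuous (fun x : 'rV[R]_m => x *m A).
Proof.
apply: continuous_rV => j; under eq_fun do rewrite mxE.
apply: continuous_sum_fun => i x.
by apply: continuousM; [exact: coord_continuous|exact: cst_continuous].
Qed.

End lebesgue_measure_rV.

(** * Affine changes of variables *)

Section affine.
Context {R : realType}.

Lemma measurable_rVD d (T : measurableType d) m (f g : T -> 'rV[R]_m) :
  measurable_fun setT f -> measurable_fun setT g ->
  measurable_fun setT (fun t => f t + g t).
Proof.
move=> mf mg; apply: measurable_fun_rVP => i.
under eq_fun do rewrite mxE.
by apply: measurable_funD; apply: (measurableT_comp (measurable_rV_coord i)).
Qed.

Lemma measurable_mulmx_rV d (T : measurableType d) m l (A : 'M[R]_(m, l))
  (f : T -> 'rV[R]_m) :
  measurable_fun setT f -> measurable_fun setT (fun t => f t *m A).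
Proof.
move=> mf; apply: (measurableT_comp (f := fun x : 'rV[R]_m => x *m A) _ mf).
by apply: continuous_measurable_rV_rV; exact: continuous_mulmx_rV.
Qed.

(* As in the proof that Haar measure is unique: averaging over the translates by
   a cube and applying Tonelli twice shows that [x |-> b + x A] scales integrals
   by a constant. *)
Lemma ge0_integral_affine_le n (A : 'M[R]_n) : A \in unitmx ->
  exists2 C : R, 0 <= C & forall (b : 'rV[R]_n) (g : 'rV[R]_n -> \bar R),
    measurable_fun setT g -> (forall x, (0 <= g x)%E) ->
    (\int[leb n]_x g (b + x *m A)%R <= C%:E * \int[leb n]_x g x)%E.
Proof.
move=> uA; pose B := @cube R n 1.
have mB : measurable B by exact: measurable_cube.
have mIB : measurable_fun setT (fun x => (\1_B x)%:E : \bar R).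
  by apply/measurable_EFinP; exact: measurable_indic.
have IB0 x : (0 <= (\1_B x : R)%:E)%E by rewrite lee_fin.
pose K := (\int[leb n]_x (\1_B (- (x *m A))%R)%:E)%E.
have mxA : measurable_fun setT (fun x : 'rV[R]_n => x *m A).
  by apply: measurable_mulmx_rV; exact: measurable_id.
have mN : measurable_fun setT (fun x : 'rV[R]_n => - x).
  apply: measurable_fun_rVP => i; under eq_fun do rewrite mxE.
  by apply: measurableT_comp => //; exact: measurable_rV_coord.
have mK : measurable_fun setT (fun x => (\1_B (- (x *m A))%R)%:E : \bar R).
  exact: (measurableT_comp mIB (measurableT_comp mN mxA)).
have K0 : (0 <= K)%E by apply: integral_ge0.
have Kfin : K \is a fin_num.
  (* If - x A lies in the cube of half-side 1, then x, being (x A) A^-1, lies in the cube of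
     half-side [c]; so [K] is at most the volume of the latter. *)
  pose c : R := \sum_i \sum_j `|invmx A i j|.
  have c0 : 0 <= c by rewrite sumr_ge0// => i _; rewrite sumr_ge0.
  rewrite ge0_fin_numE//.
  apply: (@le_lt_trans _ _ (\int[leb n]_x (\1_(@cube R n c) x)%:E)%E).
    apply: ge0_le_integral => //.
    - by apply/measurable_EFinP/measurable_indic; exact: measurable_cube.
    - move=> x _; rewrite lee_fin !indicE.
      have [xB|xB] := boolP (_ \in B); last by rewrite ler0n.
      rewrite ler_nat mem_set// => i /=.
      rewrite -[x](mulmxK uA) !mxE in_itv/= -ler_norml.
      apply: (le_trans (ler_norm_sum _ _ _)).
      apply: ler_sum => k _.
      rewrite (bigD1 i)//= normrM -[leLHS]addr0 lerD// ?sumr_ge0//.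
      rewrite ler_piMl//.
      move: xB; rewrite inE => /(_ k)/=; rewrite in_itv/= -ler_norml.
      by rewrite mxE normrN.
  rewrite integral_indic//; last exact: measurable_cube.
  by rewrite setIT [X in (X < _)%E](leb_cube n c0) ltry.
pose V : R := 2 ^+ n.
have V0 : 0 < V by rewrite exprn_gt0.
have IBV : (\int[leb n]_x (\1_B x)%:E = V%:E)%E.
  by rewrite integral_indic// setIT [LHS](leb_cube n ler01) mulr1.
exists (V^-1 * fine K).
  by rewrite mulr_ge0// ?invr_ge0 ?(ltW V0)// fine_ge0.
move=> b g mg g0.
pose I := (\int[leb n]_x g (b + x *m A)%R)%E.
have mfst : measurable_fun setT (@fst 'rV[R]_n 'rV[R]_n)
  by exact: measurable_fst.
have msnd : measurable_fun setT (@snd 'rV[R]_n 'rV[R]_n)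
  by exact: measurable_snd.
have mbA : measurable_fun setT (fun x : 'rV[R]_n => b + x *m A).
  by apply: measurable_rVD => //; exact: measurable_cst.
have mgA : measurable_fun setT (fun x : 'rV[R]_n => g (b + x *m A)).
  exact: (measurableT_comp mg).
have I0 : (0 <= I)%E by apply: integral_ge0.
suff : (V%:E * I = K * \int[leb n]_x g x)%E.
  move=> E; rewrite EFinM fineK// -muleA -E muleA -EFinM mulVf ?gt_eqF//
    mul1e//.
(* For fixed x, [G1] becomes [G2] when y is translated by b + x A. Integrating [G1] over x first
   gives V times I; integrating [G2] over x first gives K times the integral of g. *)
pose G1 (p : 'rV[R]_n * 'rV[R]_n) : \bar R :=
  ((\1_B p.1)%:E * g (b + p.2 *m A + p.1)%R)%E.
pose G2 (p : 'rV[R]_n * 'rV[R]_n) : \bar R :=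
  ((\1_B (p.1 - (b + p.2 *m A))%R)%:E * g p.1)%E.
have mp2 : measurable_fun setT (fun p : 'rV[R]_n * 'rV[R]_n => b + p.2 *m A).
  exact: (measurableT_comp mbA msnd).
have mG1 : measurable_fun setT G1.
  apply: emeasurable_funM; first exact: (measurableT_comp mIB).
  by apply: (measurableT_comp mg); apply: measurable_rVD.
have mG2 : measurable_fun setT G2.
  apply: emeasurable_funM; last exact: (measurableT_comp mg).
  apply: (measurableT_comp mIB); apply: measurable_rVD => //.
  exact: (measurableT_comp mN).
have G10 p : (0 <= G1 p)%E by rewrite mule_ge0.
have G20 p : (0 <= G2 p)%E by rewrite mule_ge0.
(* A translation by c after x A is a translation by c A^-1 before it; this is where invertibility
   turns translation invariance into invariance along the image. *)
have shift_mA (h : 'rV[R]_n -> \bar R) (c : 'rV[R]_n) : measurable_fun setT h ->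
    (forall x, 0 <= h x)%E ->
    (\int[leb n]_x h (x *m A + c)%R = \int[leb n]_x h (x *m A))%E.
  move=> mh h0.
  have mhA : measurable_fun setT (fun x : 'rV[R]_n => h (x *m A)).
    exact: (measurableT_comp mh).
  rewrite -(ge0_integral_leb_shift (c *m invmx A) mhA)//.
  by apply: eq_integral => x _; rewrite mulmxDl mulmxKV.
transitivity (\int[leb n]_y \int[leb n]_x G1 (y, x))%E.
  rewrite -IBV muleC -ge0_integralZl//.
  apply: eq_integral => y _; rewrite /G1/=.
  rewrite ge0_integralZl//; last first.
    apply: (measurableT_comp mg); apply: measurable_rVD => //.
  rewrite muleC; congr (_ * _)%E.
  apply: etrans; first apply/esym/(@shift_mA (fun x => g (b + x)) y) => //.
    by apply: (measurableT_comp mg); apply: measurable_rVD.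
  by apply: eq_integral => x _; rewrite addrA.
rewrite (fubini_tonelli _ mG1 G10).
transitivity (\int[leb n]_x \int[leb n]_y G2 (y, x))%E.
  apply: eq_integral => x _.
  have mx : measurable_fun setT (pair^~ x : 'rV[R]_n -> 'rV[R]_n * 'rV[R]_n).
    exact: measurable_pair2.
  rewrite -(ge0_integral_leb_shift (b + x *m A) (measurableT_comp mG2 mx)
    (fun y => G20 _)).
  by apply: eq_integral => y _; rewrite /G1 /G2/= addrK addrC.
transitivity (\int[leb n]_y \int[leb n]_x G2 (y, x))%E.
  exact/esym/(fubini_tonelli _ mG2 G20).
rewrite -ge0_integralZl//; apply: eq_integral => y _; rewrite /G2/=.
rewrite ge0_integralZr//; last first.
  apply: (measurableT_comp mIB); apply: measurable_rVD => //.
  exact: (measurableT_comp mN).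
congr (_ * _)%E.
have mh : measurable_fun setT (fun x : 'rV[R]_n => (\1_B (- x)%R)%:E : \bar R).
  exact: (measurableT_comp mIB).
rewrite /K -(@shift_mA (fun x => (\1_B (- x)%R)%:E) (b - y))//.
by apply: eq_integral => x _;
  rewrite [in RHS]opprD opprB addrC opprD addrA [in RHS]addrC addrA.
Qed.
End affine.

(** * Calculus of C1 functions *)

Section calculus.
Context {R : realType}.

Lemma is_derive_line (V : normedModType R) (f : V -> R) (a b : V) (t l : R) :
  is_derive (a + t *: b) b f l -> is_derive t 1 (fun s : R => f (a + s *: b)) l.
Proof.
move=> [df <-].
have E : (fun h : R => h^-1 *:
      (((fun s : R => f (a + s *: b)) \o shift t) (h *: 1) - f (a + t *: b))) =
    (fun h : R => h^-1 *:
      ((f \o shift (a + t *: b)) (h *: b) - f (a + t *: b))).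
  apply/funext => h /=; congr (_ *: (f _ - _)).
  by rewrite /= scalerDl [h%:A]mulr1 addrCA.
by split; rewrite /derivable /derive E.
Qed.

Lemma is_derive_cvg (V : normedModType R) (f : V -> R) (a v : V) (l : R) :
  h^-1 *: ((f \o shift a) (h *: v) - f a) @[h --> 0^'] --> l ->
  is_derive a v f l.
Proof. by move=> fl; split; [apply/cvg_ex; exists l|exact/cvg_lim]. Qed.

(** The difference quotient along d + c e is the one along d plus one along e based at the moving
    point x + h d. The mean value theorem turns the latter into c times a derivative at a point
    tending to x, and continuity of that derivative concludes. *)
Lemma is_derive_addZ (V : normedModType R) (f : V -> R) (x d e : V) (c l : R) :
  (forall y, derivable f y e) -> continuous ('D_e f) ->
  is_derive x d f l -> is_derive x (d + c *: e) f (l + c * 'D_e f x).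
Proof.
move=> df cf [dfd <-]; apply: is_derive_cvg.
have mvt (a : V) (h : R) : exists2 th : R, `|th| <= `|h| &
    f (a + h *: e) - f a = 'D_e f (a + th *: e) * h.
  have dl (t : R) :
    is_derive t 1 (fun s : R => f (a + s *: e)) ('D_e f (a + t *: e)).
    by apply: is_derive_line; exact: derivableP.
  have cl : continuous (fun s : R => f (a + s *: e)).
    by move=> s; apply/differentiable_continuous/derivable1_diffP.
  have [h0|h0] := leP 0 h.
    have [|s] :=
      @MVT_segment R (fun s => f (a + s *: e)) _ 0 h h0 (fun t _ => dl t).
      exact: continuous_subspaceT.
    rewrite in_itv/= => /andP[s0 sh] E; exists s; first by rewrite !ger0_norm.
    by move: E; rewrite scale0r addr0 subr0.
  have [|s] :=
    @MVT_segment R (fun s => f (a + s *: e)) _ h 0 (ltW h0) (fun t _ => dl t).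
    exact: continuous_subspaceT.
  rewrite in_itv/= => /andP[s0 sh] E; exists s.
    by rewrite !ler0_norm// ?lerN2// ltW.
  by move: E; rewrite scale0r addr0 sub0r mulrN => /eqP;
    rewrite -eqr_oppLR opprB => /eqP.
pose q1 (h : R) := h^-1 *: ((f \o shift x) (h *: d) - f x).
pose q2 (h : R) := h^-1 *: (f (x + h *: d + (h * c) *: e) - f (x + h *: d)).
have -> : (fun h : R => h^-1 *: ((f \o shift x) (h *: (d + c *: e)) - f x)) =
  q1 \+ q2.
  apply/funext => h; rewrite /q1 /q2 /= -scalerDr; congr (_ *: _).
  by rewrite scalerDr scalerA [RHS]addrC (addrC x) subrKA (addrAC (h *: d)).
apply: cvgD; first exact: dfd.
apply/cvgrPdist_lt => eps eps0.
(* The intermediate point is at distance at most |h| K from x; the summand 1 only makes K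
   positive. *)
pose K := `|d| + `|c| * `|e| + 1.
have K0 : 0 < K by rewrite ltr_wpDl.
have c10 : 0 < `|c| + 1 by rewrite ltr_wpDl.
have /cvgrPdist_lt/(_ _ (divr_gt0 eps0 c10)) := cf x.
move=> /nbhs_ballP[del /= del0 Hdel].
near=> h.
have h0 : h != 0 by near: h; exact: nbhs_dnbhs_neq.
have hdel : `|h| < del / K.
  by near: h; apply: dnbhs0_lt; rewrite divr_gt0.
rewrite /q2; have [th thh ->] := mvt (x + h *: d) (h * c).
set y := _ + th *: e.
have -> : h^-1 *: ('D_e f y * (h * c)) = c * 'D_e f y.
  by rewrite /GRing.scale/=; field.
rewrite -mulrBr normrM.
have yx : `|'D_e f x - 'D_e f y| < eps / (`|c| + 1).
  apply: Hdel; rewrite -ball_normE/= /y opprD addrA opprD addrA subrr sub0r.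
  rewrite -opprD normrN (le_lt_trans (ler_normD _ _))// !normrZ.
  apply: (@le_lt_trans _ _ (`|h| * K)); last by rewrite -ltr_pdivlMr.
  rewrite /K 2!mulrDr -addrA lerD2l -[leLHS]addr0 lerD ?mulr_ge0//.
  by rewrite mulrA ler_wpM2r// -normrM.
apply: (@le_lt_trans _ _ (`|c| * (eps / (`|c| + 1)))).
  by rewrite ler_wpM2l// ltW.
by rewrite mulrA ltr_pdivrMr// mulrDr mulr1 (mulrC eps) ltrDl.
Unshelve. all: by end_near.
Qed.

Definition C1 n (w : 'rV[R]_n -> R) : Prop :=
  continuous w /\
  forall i, (forall x, derivable w x 'e_i) /\ continuous ('D_('e_i) w).

(** The direction is built up one coordinate at a time, each step adding a multiple of ['e_i]. *)
Lemma C1_is_derive n (w : 'rV[R]_n -> R) (x d : 'rV[R]_n) : C1 w ->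
  is_derive x d w (\sum_i d ord0 i * 'D_('e_i) w x).
Proof.
move=> [_ dw]; rewrite {1}[d]row_sum_delta.
elim: (index_enum _) => [|i s ih].
  by rewrite !big_nil; exact: is_derive0.
rewrite !big_cons addrC (addrC (_ * _)).
by have [d1 d2] := dw i; apply: is_derive_addZ.
Qed.

(** Cauchy-Schwarz against the constant family 1, by summing a_i a_j <= (a_i^2 + a_j^2) / 2. *)
Lemma sqr_sum_le m (a : 'I_m -> R) :
  (\sum_i a i) ^+ 2 <= m%:R * \sum_i a i ^+ 2.
Proof.
have E1 : (\sum_i a i) ^+ 2 = \sum_i \sum_j a i * a j.
  by rewrite expr2 mulr_suml; apply: eq_bigr => i _; rewrite mulr_sumr.
have E2 : m%:R * \sum_i a i ^+ 2 =
  \sum_(i < m) \sum_(j < m) (a i ^+ 2 + a j ^+ 2) / 2.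
  have E3 i : \sum_(j < m) (a i ^+ 2 + a j ^+ 2) / 2 =
      (a i ^+ 2 *+ m + \sum_j a j ^+ 2) / 2.
    by rewrite -mulr_suml big_split/= sumr_const card_ord.
  rewrite (eq_bigr _ (fun i _ => E3 i)) -mulr_suml big_split/= sumr_const
    card_ord.
  by rewrite sumrMnl mulr_natl -mulr2n -[_ *+ 2]mulr_natr mulfK.
rewrite E1 E2; apply: ler_sum => i _; apply: ler_sum => j _.
have := sqr_ge0 (a i - a j); lra.
Qed.

End calculus.

(** * Trace inequality along a segment *)

Section trace_line.
Context {R : realType}.

Definition h1density n (w : 'rV[R]_n -> R) (y : 'rV[R]_n) : R :=
  w y ^+ 2 + \sum_i ('D_('e_i) w y) ^+ 2.

Lemma h1density_ge0 n (w : 'rV[R]_n -> R) y : 0 <= h1density w y.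
Proof. by rewrite addr_ge0 ?sqr_ge0// sumr_ge0// => i _; rewrite sqr_ge0. Qed.

Lemma continuous_h1density n (w : 'rV[R]_n -> R) : C1 w ->
  continuous (h1density w).
Proof.
move=> [cw dw]; apply: continuous_addf; first exact: continuous_sqrf.
by apply: continuous_sum_fun => i; apply: continuous_sqrf; have [] := dw i.
Qed.

(* Integrates the derivative of [s |-> (1 - s / del) * w (x + s d) ^ 2]. *)
Lemma sqr_le_integral_line n (d : 'rV[R]_n) (del : R) : 0 < del ->
  exists2 K : R, 0 <= K & forall (w : 'rV[R]_n -> R) x, C1 w ->
    ((w x ^+ 2)%:E <= \int[lebesgue_measure]_(s in `]0%R, del[)
       (K * h1density w (x + s *: d))%:E)%E.
Proof.
move=> del0; pose S : R := \sum_i d ord0 i ^+ 2.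
have S0 : 0 <= S by rewrite sumr_ge0// => i _; rewrite sqr_ge0.
(* [del^-1] is the slope of the weight; 1 and n S come from 2 a psi psi' <= psi^2 + psi'^2, valid
   for |a| <= 1, and from psi'^2 <= n S |grad w|^2. *)
exists (del^-1 + 1 + n%:R * S).
  by rewrite !addr_ge0// ?invr_ge0 ?mulr_ge0// ltW.
set K := _ + _ => w x Cw; have [cw dw] := Cw.
pose psi (s : R) := w (x + s *: d).
pose psi' (s : R) := \sum_i d ord0 i * 'D_('e_i) w (x + s *: d).
have dpsi (s : R) : is_derive s 1 psi (psi' s).
  by apply: is_derive_line; exact: C1_is_derive.
have cline (g : 'rV[R]_n -> R) : continuous g ->
  continuous (fun s : R => g (x + s *: d)).
  move=> cg s; apply: (continuous_comp (f := fun s : R => x + s *: d) (g := g)).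
    apply: (continuousD (f := cst x) (g := fun s : R => s *: d)).
      exact: cst_continuous.
    exact: scalel_continuous.
  exact: cg.
have cpsi : continuous psi by exact: (cline w).
have cpsi' : continuous psi'.
  apply: continuous_sum_fun => i; apply: continuous_mulf;
    first exact: cst_continuous.
  by apply: (cline ('D_('e_i) w)); have [_] := dw i.
(* The weight is taken with the opposite sign, so that F del = 0 and F 0 = - w x ^+ 2. *)
pose a (s : R) : R := s * del^-1 - 1.
have da (s : R) : is_derive s 1 a del^-1.
  apply: is_derive_eq; rewrite /GRing.scale/=.
  ring.
pose F (s : R) : R := a s * (psi s * psi s).
pose F' (s : R) : R :=
  a s * (psi s * psi' s + psi s * psi' s) + (psi s * psi s) * del^-1.
have dF (s : R) : is_derive s 1 F (F' s).
  by apply: is_derive_eq; rewrite /F' /GRing.scale/=.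
have ca : continuous a.
  by move=> s; apply/differentiable_continuous/derivable1_diffP.
have cF : continuous F.
  by move=> s; apply/differentiable_continuous/derivable1_diffP.
have cF' : continuous F'.
  apply: continuous_addf; last by apply: continuous_mulf;
    [exact: continuous_mulf|exact: cst_continuous].
  by apply: continuous_mulf => //; apply: continuous_addf;
    exact: continuous_mulf.
have -> : w x ^+ 2 = F del - F 0.
  rewrite /F /a mul0r mulfV ?gt_eqF// subrr mul0r /psi scale0r addr0; ring.
have cH : continuous (fun s : R => K * h1density w (x + s *: d)).
  apply: continuous_mulf; first exact: cst_continuous.
  by apply: (cline (h1density w)); exact: continuous_h1density.
rewrite EFinB -(@continuous_FTC2 _ F' F 0 del)//; last 3 first.
- exact: continuous_subspaceT.
- split=> [s _||].
  + by [].
  + exact/cvg_at_right_filter/cF.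
  + exact/cvg_at_left_filter/cF.
- by move=> s _; rewrite derive1E derive_val.
have int_cts (g : R -> R) : continuous g ->
    lebesgue_measure.-integrable `[0, del] (EFin \o g).
  move=> cg; apply: continuous_compact_integrable; first exact: segment_compact.
  exact: continuous_subspaceT.
rewrite -(@integral_itv_bndoo R 0 del _ true false); last first.
  apply/measurable_EFinP; apply: open_continuous_measurable_fun.
    exact: interval_open.
  by move=> s _; exact: cH.
apply: le_integral => //; [exact: int_cts|exact: int_cts|].
move=> s; rewrite inE/= in_itv/= => /andP[s0 sd]; rewrite lee_fin.
have a1 : a s ^+ 2 <= 1.
  have sd1 : 0 <= s * del^-1 <= 1.
    by rewrite divr_ge0// ?(ltW del0)// ler_pdivrMr// mul1r.
  by rewrite /a; nra.
set D := \sum_i ('D_('e_i) w (x + s *: d)) ^+ 2.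
have D0 : 0 <= D by rewrite sumr_ge0// => i _; rewrite sqr_ge0.
have p1 : psi' s ^+ 2 <= n%:R * S * D.
  apply: (le_trans (sqr_sum_le _)); rewrite -mulrA ler_wpM2l//.
  rewrite mulr_sumr; apply: ler_sum => i _; rewrite exprMn ler_wpM2r ?sqr_ge0//.
  by rewrite /S (bigD1 i)//= lerDl sumr_ge0// => j _; rewrite sqr_ge0.
have W0 : 0 <= psi s ^+ 2 by rewrite sqr_ge0.
have dV : 0 <= del^-1 by rewrite invr_ge0 ltW.
have nS : 0 <= n%:R * S by rewrite mulr_ge0.
have h1 : 2 * (a s * (psi s * psi' s)) <= psi s ^+ 2 + n%:R * S * D.
  have := sqr_ge0 (a s * psi s - psi' s).
  have : a s ^+ 2 * psi s ^+ 2 <= psi s ^+ 2 by rewrite ler_piMl.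
  lra.
rewrite /F' /K /h1density -/D -/(psi s).
have h2 : 0 <= (del^-1 + 1) * D by rewrite mulr_ge0// addr_ge0.
have h3 : 0 <= n%:R * S * psi s ^+ 2 by rewrite mulr_ge0.
lra.
Qed.
End trace_line.

(** * Geometry of simplices and facets *)

Section enumeration.

(** The last clause ties the enumeration to [nth] on [enum], through which [facet_vertex] is
    defined. *)
Lemma set_enumeration (V : finType) (F : {set V}) m : #|F| = m.+1 ->
  exists (e : 'I_m.+1 -> V) (e' : V -> 'I_m.+1),
    [/\ cancel e e', {in F, cancel e' e}, forall k, e k \in F
      & forall (k : 'I_m.+1) x, nth x (enum F) k = e k].
Proof.
move=> Fm; have [a0 a0F] : exists a, a \in F.
  by apply/set0Pn; rewrite -card_gt0 Fm.
exists (fun k => enum_val (cast_ord (esym Fm) k)).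
exists (fun a => cast_ord Fm (enum_rank_in a0F a)); split.
- by move=> k; rewrite enum_valK_in cast_ordKV.
- by move=> a aF; rewrite cast_ordK enum_rankK_in.
- by move=> k; exact: enum_valP.
- by move=> k x; rewrite (enum_val_nth x).
Qed.

Lemma big_enumeration (W : nmodType) (V : finType) (F : {set V}) m
    (e : 'I_m -> V) (e' : V -> 'I_m) (g : V -> W) :
  cancel e e' -> {in F, cancel e' e} -> (forall k, e k \in F) ->
  \sum_(a in F) g a = \sum_k g (e k).
Proof.
move=> ee' e'e eF; rewrite (reindex e)/=; last first.
  by exists e' => a; [move=> _; exact: ee'|exact: e'e].
by apply: eq_bigl => k; rewrite eF.
Qed.

End enumeration.

Section geometry.
Context {R : realType} {n : nat} (M : mesh R n).
Local Notation E := 'rV[R]_n.+1.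
Local Notation vert := (vertex M).
Implicit Types (S T F : {set vert}).

Lemma affinely_independent_inj S (w w' : vert -> R) : affinely_independent S ->
  \sum_(i in S) w i = \sum_(i in S) w' i ->
  \sum_(i in S) w i *: pos i = \sum_(i in S) w' i *: pos i ->
  forall i, i \in S -> w i = w' i.
Proof.
move=> aS w1 w2 i iS; apply/eqP; rewrite -subr_eq0; apply/eqP.
apply: (aS (fun i => w i - w' i)) => //; first by rewrite sumrB w1 subrr.
by under eq_bigr do rewrite scalerBl; rewrite sumrB w2 subrr.
Qed.

Lemma sum_indicator (W : lmodType R) S (g : vert -> W) b : b \in S ->
  \sum_(a in S) (a == b)%:R *: g a = g b.
Proof.
move=> bS; rewrite (bigD1 b)//= eqxx scale1r big1 ?addr0// => a
  /andP[_ /negbTE ->].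
by rewrite scale0r.
Qed.

Lemma sum_indicator1 S b : b \in S -> \sum_(a in S) ((a == b)%:R : R) = 1.
Proof.
move=> bS; rewrite (bigD1 b)//= eqxx big1 ?addr0// => a /andP[_ /negbTE ->//].
Qed.

Lemma sum_if_subset (W : nmodType) S S' (g : vert -> W) : S \subset S' ->
  \sum_(i in S') (if i \in S then g i else 0) = \sum_(i in S) g i.
Proof.
move=> /finset.setIidPr SS'; rewrite -big_mkcondr/= -{2}SS'.
by apply: eq_bigl => i; rewrite inE.
Qed.

Lemma sumZ_if_subset (W : lmodType R) S S' (c : vert -> R) (g : vert -> W) :
  S \subset S' ->
  \sum_(i in S') (if i \in S then c i else 0) *: g i = \sum_(i in S) c i *: g i.
Proof.
move=> SS'; rewrite -(sum_if_subset _ SS'); apply: eq_bigr => i _.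
by case: ifP => // _; rewrite scale0r.
Qed.

(** The rows of [H] are (1, pos a), so v H lists the sum of the weights v and the weighted sum of
    the vertices. Affine independence says that [H] is invertible, and (1, x) H^-1 are the
    barycentric coordinates, extended to the whole space. Their continuity makes open simplices open
    and simplices closed. *)
Lemma barycentric T : #|T| = n.+2 -> affinely_independent T ->
  exists beta : vert -> E -> R,
    (forall a, continuous (beta a)) /\
    forall x, \sum_(a in T) beta a x = 1 /\
              x = \sum_(a in T) beta a x *: pos a.
Proof.
move=> Tn aT; have [e [e' [ee' e'e eT _]]] := set_enumeration Tn.
pose H : 'M[R]_(n.+2, 1 + n.+1) :=
  \matrix_(i < n.+2) row_mx (const_mx 1 : 'rV_1) (pos (e i)).
have Hrow (v : 'rV[R]_n.+2) : v *m H =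
  row_mx (const_mx (\sum_(a in T) v ord0 (e' a)))
    (\sum_(a in T) v ord0 (e' a) *: pos a).
  rewrite mulmx_sum_row !(big_enumeration _ ee' e'e eT).
  apply/rowP => k; rewrite summxE.
  under eq_bigr do rewrite /H mxE rowK.
  case: (split_ordP k) => j ->; rewrite ?row_mxEl ?row_mxEr/=.
    rewrite mxE; apply: eq_bigr => i _.
    by rewrite row_mxEl mxE mulr1 ee'.
  rewrite summxE; apply: eq_bigr => i _.
  by rewrite row_mxEr mxE ee'.
have uH : H \in unitmx.
  rewrite -row_free_unit; apply/inj_row_free => v.
  rewrite Hrow => h; set A := const_mx _ in h; set B := \sum_(_ in _) _ in h.
  have /eq_row_mx[/rowP/(_ ord0)] : row_mx A B = row_mx 0 0 by rewrite row_mx0.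
  rewrite !mxE => h1 h2.
  apply/rowP => i; rewrite mxE -[i]ee'.
  exact: (aT (fun a => v ord0 (e' a))).
exists (fun a x => (row_mx (const_mx 1 : 'rV_1) x *m invmx H) ord0 (e' a));
  split.
  move=> a; under eq_fun do rewrite mxE.
  apply: continuous_sum_fun => i.
  apply: (continuous_mulf
    (f := fun x : E => row_mx (const_mx 1 : 'rV_1) x ord0 i));
    last exact: cst_continuous.
  case: (split_ordP i) => j ->.
    by under eq_fun do rewrite row_mxEl mxE; exact: cst_continuous.
  by under eq_fun do rewrite row_mxEr; exact: coord_continuous.
move=> x; have := Hrow (row_mx (const_mx 1 : 'rV_1) x *m invmx H).
rewrite mulmxKV// => /eq_row_mx[/rowP/(_ ord0)]; rewrite !mxE => h1 h2.
by split.
Qed.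

Lemma open_simplexE T (beta : vert -> E -> R) : affinely_independent T ->
  (forall x, \sum_(a in T) beta a x = 1 /\
             x = \sum_(a in T) beta a x *: pos a) ->
  open_simplex T = [set x | forall a, a \in T -> 0 < beta a x].
Proof.
move=> aT hb; apply/seteqP; split => x /=.
  move=> [w [w0 w1 wx]] a aT'; have [b1 bx] := hb x.
  rewrite -(@affinely_independent_inj T w (beta^~ x))// ?w0// ?b1//.
  by rewrite -wx.
by move=> bx; exists (beta^~ x); have [b1 b2] := hb x.
Qed.

Lemma simplexE T (beta : vert -> E -> R) : affinely_independent T ->
  (forall x, \sum_(a in T) beta a x = 1 /\
             x = \sum_(a in T) beta a x *: pos a) ->
  simplex T = [set x | forall a, a \in T -> 0 <= beta a x].
Proof.
move=> aT hb; apply/seteqP; split => x /=.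
  move=> [w [w0 w1 wx]] a aT'; have [b1 bx] := hb x.
  rewrite -(@affinely_independent_inj T w (beta^~ x))// ?w0// ?b1//.
  by rewrite -wx.
by move=> bx; exists (beta^~ x); have [b1 b2] := hb x.
Qed.

Lemma open_open_simplex T : #|T| = n.+2 -> affinely_independent T ->
  open (open_simplex T).
Proof.
move=> Tn aT; have [beta [cb hb]] := barycentric Tn aT.
rewrite (open_simplexE aT hb) openE => x /= bx.
near=> y => a; move: a; near: y.
apply: filter_forall => a.
have [aT'|/negbTE aT'] := boolP (a \in T); last exact: nearW.
near=> y => _; near: y; apply: (cvgr_gt (beta a x)); last exact: bx.
exact: cb.
Unshelve. all: by end_near.
Qed.

Lemma closed_simplex T : #|T| = n.+2 -> affinely_independent T ->
  closed (simplex T).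
Proof.
move=> Tn aT; have [beta [cb hb]] := barycentric Tn aT.
rewrite (simplexE aT hb) => x /= cx a aT'.
rewrite leNgt; apply/negP => bx.
have /cx[y [/= /(_ _ aT') + ]] : \forall y \near x, beta a y < 0.
  by near=> y; near: y; apply: (cvgr_lt (beta a x)); [exact: cb|].
by rewrite leNgt => /negP.
Unshelve. all: by end_near.
Qed.

Lemma open_simplex_sub T : open_simplex T `<=` simplex T.
Proof. by move=> x [w [w0 w1 wx]]; exists w; split => // i /w0/ltW. Qed.

(** By conformity a common point is a combination of the vertices of T :&: T'. Its barycentric
    coordinates in T are unique and all positive, so every vertex of T belongs to T', and
    conversely. *)
Lemma trivIset_open_simplex Om sigma : triangulation M Om sigma ->
  trivIset [set` cells M] (@open_simplex R n M).
Proof.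
move=> [cM conf _ _ _] T T' /= TM T'M [x [xT xT']].
have sub S S' : S \in cells M -> S' \in cells M -> open_simplex S x ->
  open_simplex S' x ->
    S \subset S'.
  move=> SM S'M xS xS'.
  have : (simplex S `&` simplex S') x by split; exact: open_simplex_sub.
  rewrite conf// => -[v [v0 v1 vx]]; have [w [w0 w1 wx]] := xS.
  apply/fintype.subsetP => a aS; apply: contraT => aS'.
  have [_ aiS] := cM _ SM.
  have := @affinely_independent_inj S w
    (fun i => if i \in S :&: S' then v i else 0) aiS.
  rewrite sum_if_subset ?finset.subsetIl// w1 v1 => /(_ erefl).
  rewrite sumZ_if_subset ?finset.subsetIl// -wx -vx => /(_ erefl _ aS).
  rewrite inE aS/=.
  by rewrite (negbTE aS') => wa0; have := w0 _ aS; rewrite wa0 ltxx.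
by apply/eqP; rewrite finset.eqEsubset !sub.
Qed.


(* Slightly beyond a relatively interior point of the facet, as seen from the
   vertex of [T] off [F], there is no cell. *)
Lemma boundary_facet_disjoint Om sigma T F : triangulation M Om sigma ->
  open Om ->
  T \in cells M -> F \subset T -> #|F| = n.+1 ->
  (forall T', T' \in cells M -> F \subset T' -> T' = T) ->
  forall x, simplex F x -> ~ Om x.
Proof.
move=> [cM conf clOm _ _] oOm TM FT Fn Tonly x Fx Omx.
have [Tn aT] := cM _ TM.
have line (z d : E) : z + e *: d @[e --> (0 : R)^'+] --> z.
  apply: cvg_at_right_filter; rewrite -[X in _ --> X]addr0 -(scale0r d).
  apply: (@continuousD _ _ _ (cst z) (fun e : R => e *: d)).
    exact: cst_continuous.
  exact: scalel_continuous.
(* Moving x slightly towards the barycentre b of F makes all weights positive without leaving the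
   open set. *)
have [z [[w [w0 w1 wx]] Omz]] : open_simplex F `&` Om !=set0.
  have [w [w0 w1 wx]] := Fx.
  pose b : E := \sum_(i in F) n.+1%:R^-1 *: pos i.
  have nOm : \forall e \near (0 : R)^'+, Om (x + e *: (b - x)).
    by apply: line; exact: open_nbhs_nbhs.
  near (0 : R)^'+ => e; exists (x + e *: (b - x)); split; last by near: e.
  exists (fun i => (1 - e) * w i + e * n.+1%:R^-1).
  have e0 : 0 < e by near: e; exact: nbhs_right_gt.
  have e1 : e < 1 by near: e; exact: nbhs_right_lt.
  split.
  - move=> i iF; rewrite ltr_wpDl// ?mulr_gt0 ?invr_gt0// mulr_ge0 ?w0//.
    by rewrite subr_ge0 ltW.
  - rewrite big_split/= -!mulr_sumr w1 sumr_const Fn -[_ *+ n.+1]mulr_natr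
      mulVf ?pnatr_eq0//.
    by rewrite !mulr1 subrK.
  - under eq_bigr do rewrite scalerDl -!scalerA.
    rewrite big_split/= -!scaler_sumr -wx -/b.
    by rewrite /b -scaler_sumr scalerBl scale1r scalerBr addrAC -addrA.
have [q qT qF] : exists2 q, q \in T & q \notin F.
  apply: contrapT => h; have : T \subset F.
    by apply/fintype.subsetP => q qT; apply: contraT => qF; case: h; exists q.
  by move=> /subset_leq_card; rewrite Tn Fn ltnn.
(* By conformity z would be a combination of vertices of T :&: T'; as its weights on F are positive,
   F would be contained in T', whence T' = T. *)
have out T' : T' \in cells M -> T' != T -> ~ simplex T' z.
  move=> T'M T'T T'z; move/eqP: T'T; apply; apply: Tonly => //.
  have [T'n aT'] := cM _ T'M.
  have : (simplex T `&` simplex T') z.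
    split=> //; exists (fun i => if i \in F then w i else 0); split.
    - by move=> i _; case: ifP => // /w0/ltW.
    - by rewrite sum_if_subset.
    - by rewrite sumZ_if_subset.
  rewrite conf// => -[v [v0 v1 vz]].
  apply/fintype.subsetP => a aF; apply: contraT => aT'F.
  have := @affinely_independent_inj T (fun i => if i \in F then w i else 0)
    (fun i => if i \in T :&: T' then v i else 0) aT.
  rewrite !sum_if_subset ?finset.subsetIl// w1 v1 => /(_ erefl).
  rewrite !sumZ_if_subset ?finset.subsetIl// -wx -vz => /(_ erefl a).
  rewrite (fintype.subsetP FT)// aF inE (negbTE aT'F) andbF => /(_ isT) wa0.
  by have := w0 _ aF; rewrite wa0 ltxx.
pose y e := z + e *: (z - pos q).
have yOm : \forall e \near (0 : R)^'+, Om (y e).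
  by apply: line; exact: open_nbhs_nbhs.
have yout : \forall e \near (0 : R)^'+, forall T', T' \in cells M -> T' != T ->
  ~ simplex T' (y e).
  near=> e => T'; move: T'; near: e; apply: filter_forall => T'.
  have [T'M|/negbTE T'M] := boolP (T' \in cells M); last by apply: nearW => e.
  have [->|T'T] := eqVneq T' T; first by apply: nearW => e.
  have [T'n aT'] := cM _ T'M.
  have : \forall e \near (0 : R)^'+, (~` simplex T') (y e).
    apply: (@line z (z - pos q) (~` simplex T')); apply: open_nbhs_nbhs.
    split; last exact: out.
    by rewrite openC; exact: closed_simplex.
  by apply: filterS.
near (0 : R)^'+ => e.
have e0 : 0 < e by near: e; exact: nbhs_right_gt.
have : closure Om (y e) by apply: subset_closure; near: e.
rewrite clOm => -[T' T'M /= T'y].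
have T'T : T' = T.
  apply/eqP; apply: contraPT T'y => T'T.
  by move: T' T'M T'T; near: e.
rewrite {}T'T in T'y; have [v [v0 v1 vy]] := T'y.
(* In T the point y e has weights (1 + e) w on F and - e at q, and a negative weight excludes it
   from the simplex. *)
have := @affinely_independent_inj T v
  (fun i => (if i \in F then (1 + e) * w i else 0) - e * (i == q)%:R) aT.
rewrite sumrB sum_if_subset// -!mulr_sumr w1 sum_indicator1// v1 !mulr1
  addrK => /(_ erefl).
under [X in _ = X -> _]eq_bigr do rewrite scalerBl -scalerA.
rewrite sumrB sumZ_if_subset// -scaler_sumr sum_indicator// -vy.
under [X in _ = X - _ -> _]eq_bigr do rewrite -scalerA.
rewrite -scaler_sumr -wx /y scalerDl scale1r scalerBr addrA => /(_ erefl q qT).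
rewrite (negbTE qF) eqxx mulr1 sub0r => vq.
by have := v0 q qT; rewrite vq oppr_ge0 leNgt e0.
Unshelve. all: by end_near.
Qed.



End geometry.

(** * Segments entering a cell through a facet *)

Section facet_frame.
Context {R : realType} {n : nat} (M : mesh R n).
Local Notation E := 'rV[R]_n.+1.
Local Notation vert := (vertex M).
Implicit Types (S T F : {set vert}).

(** Weights on the vertices of a facet with chart coordinates t, vertex 0 taking what is left of the
    total c. The total is 1 for points of the facet and 0 for vectors parallel to it, which occur
    when [A j] is shown to be invertible. *)
Definition facet_weight (c : R) (t : 'rV[R]_n) (k : 'I_n.+1) : R :=
  if unlift ord0 k is Some i then t ord0 i else c - \sum_i t ord0 i.

Lemma sum_facet_weight c t : \sum_k facet_weight c t k = c.
Proof.
rewrite big_ord_recl /facet_weight unlift_none.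
by under [X in _ + X = _]eq_bigr do rewrite liftK; rewrite subrK.
Qed.

Lemma facet_weight_ge0 t k : ref_simplex t -> 0 <= facet_weight 1 t k.
Proof.
move=> [t0 t1]; rewrite /facet_weight.
by case: unliftP => [i _|_]; [exact: t0|rewrite subr_ge0].
Qed.

Lemma facet_enumeration F : #|F| = n.+1 ->
  exists (e : 'I_n.+1 -> vert) (e' : vert -> 'I_n.+1),
    [/\ cancel e e', {in F, cancel e' e}, forall k, e k \in F,
        facet_vertex F 0 = pos (e ord0)
      & forall c t, \sum_k facet_weight c t k *: pos (e k) =
          c *: pos (e ord0) + t *m facet_edges F].
Proof.
move=> Fn; have [e [e' [ee' e'e eF nthe]]] := set_enumeration Fn.
have fv (k : 'I_n.+1) : facet_vertex F k = pos (e k).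
  rewrite /facet_vertex (nth_map (e k)); first by rewrite nthe.
  by rewrite -cardE Fn.
have fv0 : facet_vertex F 0 = pos (e ord0) by rewrite -(fv ord0).
exists e, e'; split => // c t.
rewrite big_ord_recl /facet_weight unlift_none.
under [X in _ + X = _]eq_bigr do rewrite liftK.
rewrite mulmx_sum_row; under [in RHS]eq_bigr => i _.
  rewrite rowK fv0 -(lift0 i) fv scalerBr; over.
by rewrite sumrB -scaler_suml scalerBl addrAC addrA.
Qed.

Lemma facet_chart_simplex F t : #|F| = n.+1 -> ref_simplex t ->
  simplex F (facet_chart F t).
Proof.
move=> Fn reft; have [e [e' [ee' e'e eF fv0 wpos]]] := facet_enumeration Fn.
exists (fun a => facet_weight 1 t (e' a)); split.
- by move=> a _; exact: facet_weight_ge0.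
- rewrite (big_enumeration _ ee' e'e eF) -[RHS](sum_facet_weight 1 t).
  by apply: eq_bigr => k _; rewrite ee'.
- rewrite (big_enumeration _ ee' e'e eF) /facet_chart
    fv0 -[pos (e ord0)]scale1r.
  by rewrite -wpos; apply: eq_bigr => k _; rewrite ee'.
Qed.

(* The directions [dir j] point from the [j]-th vertex of the facet [F] to the
   barycentre of the cell [T]: moving a point of [F] along [dir j] decreases only
   its [j]-th barycentric coordinate. *)
Lemma facet_frame T F : #|T| = n.+2 -> affinely_independent T -> F \subset T ->
  #|F| = n.+1 ->
  exists (A : 'I_n.+1 -> 'M[R]_n.+1) (dir : 'I_n.+1 -> E),
    [/\ forall j, A j \in unitmx,
        forall j s t, facet_vertex F 0 + cons_rV (s, t) *m A j =
                      facet_chart F t + s *: dir j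
      & forall t, ref_simplex t -> exists j, forall s : R, 0 < s < n.+1%:R^-1 ->
          open_simplex T (facet_chart F t + s *: dir j)].
Proof.
move=> Tn aT FT Fn; have [e [e' [ee' e'e eF fv0 lam_pos]]] :=
  facet_enumeration Fn.
have eT k : e k \in T by exact/(fintype.subsetP FT)/eF.
pose N : R := n.+2%:R^-1.
have N0 : 0 < N by rewrite invr_gt0.
(* Aiming at the barycentre of T rather than at the vertex off F makes every weight but the j-th
   grow strictly, so that even boundary points of F enter the open simplex. *)
pose dir j : E := \sum_(a in T) N *: pos a - pos (e j).
(* Weight at a of s times [dir j] plus the facet point (c = 1) or parallel vector (c = 0) of
   coordinates t. *)
pose g c j s t a : R :=
  s * (N - (a == e j)%:R) + (if a \in F then facet_weight c t (e' a) else 0).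
have g_sum c j s t : \sum_(a in T) g c j s t a = c.
  rewrite big_split/= sum_if_subset// (big_enumeration _ ee' e'e eF).
  under [X in _ + X]eq_bigr do rewrite ee'.
  rewrite sum_facet_weight -mulr_sumr sumrB sum_indicator1// sumr_const Tn.
  by rewrite /N -[_ *+ _]mulr_natr mulVf ?pnatr_eq0// subrr mulr0 add0r.
have g_pos c j s t : \sum_(a in T) g c j s t a *: pos a =
    s *: dir j + (c *: pos (e ord0) + t *m facet_edges F).
  under eq_bigr do rewrite scalerDl.
  rewrite big_split/= sumZ_if_subset// (big_enumeration _ ee' e'e eF).
  under [X in _ + X = _]eq_bigr do rewrite ee'.
  rewrite lam_pos; congr (_ + _).
  under eq_bigr do rewrite -scalerA scalerBl.
  by rewrite -scaler_sumr sumrB sum_indicator.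
pose A j : 'M[R]_n.+1 := \matrix_k
  (if unlift ord0 k is Some i then row i (facet_edges F) else dir j).
have AE j s t : cons_rV (s, t) *m A j = s *: dir j + t *m facet_edges F.
  rewrite mulmx_sum_row big_ord_recl rowK unlift_none mxE unlift_none;
    congr (_ + _).
  rewrite mulmx_sum_row; apply: eq_bigr => i _.
  by rewrite rowK liftK mxE liftK.
exists A, dir; split.
- move=> j; rewrite -row_free_unit; apply/inj_row_free => y.
  have -> : y = cons_rV (y ord0 ord0, \row_i y ord0 (lift ord0 i)).
    apply/rowP => k; rewrite mxE.
    by case: (unliftP ord0 k) => [i ->|->]; rewrite ?mxE.
  set s := y _ _; set t := \row_i _.
  rewrite AE => yA0.
  (* A vector in the kernel has total weight 0, so all its weights vanish: the one at the vertex q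
     off F gives s = 0, the others then give t = 0. *)
  have ga := aT (g 0 j s t) (g_sum _ _ _ _).
  have {}ga : forall a, a \in T -> g 0 j s t a = 0.
    by apply: ga; rewrite g_pos scale0r add0r.
  have [q qT qF] : exists2 q, q \in T & q \notin F.
    apply: contrapT => h; have : T \subset F.
      by apply/fintype.subsetP => q qT; apply: contraT => qF; case: h; exists q.
    by move=> /subset_leq_card; rewrite Tn Fn ltnn.
  have s0 : s = 0.
    have := ga q qT; rewrite /g (negbTE qF) addr0.
    have -> : (q == e j) = false by apply: contraNF qF => /eqP ->.
    by rewrite subr0 => /eqP; rewrite mulf_eq0 (gt_eqF N0) orbF => /eqP.
  have t0 : t = 0.
    apply/rowP => i; have := ga _ (eT (lift ord0 i)).
    by rewrite /g s0 mul0r add0r eF ee' /facet_weight liftK => ->; rewrite mxE.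
  rewrite s0 t0; apply/rowP => k; rewrite !mxE.
  by case: unliftP => [i _|_] /=; rewrite ?mxE.
- move=> j s t; rewrite AE fv0 /facet_chart fv0 addrCA addrC -addrA;
    congr (_ + _).
- move=> t reft.
  have [j lamj] : exists j, n.+1%:R^-1 <= facet_weight 1 t j.
    apply: contrapT => h.
    have : \sum_k facet_weight 1 t k < \sum_(k < n.+1) (n.+1%:R^-1 : R).
      apply: ltr_sum.
        by apply/hasP; exists ord0 => //; rewrite mem_index_enum.
      by move=> k _; rewrite ltNge; apply/negP => lk; apply: h; exists k.
    rewrite sum_facet_weight sumr_const card_ord -[_ *+ _]mulr_natr
      mulVf ?pnatr_eq0//.
    by rewrite ltxx.
  exists j => s /andP[s0 s1]; exists (g 1 j s t); split.
  + move=> a aT'; rewrite /g.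
    have sN : 0 < s * N by rewrite mulr_gt0.
    (* The weight at [e j] starts from at least 1/(n+1) and drops by less than s. *)
    have [->|aj] := eqVneq a (e j).
      rewrite eF ee' /= mulrBr mulr1 -addrA addr_gt0// addrC subr_gt0.
      exact: lt_le_trans lamj.
    rewrite /= subr0 ltr_pwDl//; case: ifP => // _; exact: facet_weight_ge0.
  + exact: g_sum.
  + by rewrite g_pos scale1r addrC /facet_chart fv0.
Qed.

End facet_frame.

(** * Trace inequality *)

Section trace_inequality.
Context {R : realType} {n : nat} (M : mesh R n).
Local Notation E := 'rV[R]_n.+1.
Local Notation vert := (vertex M).
Implicit Types (S T F : {set vert}).

Lemma measurable_ref_simplex : measurable (@ref_simplex R n).
Proof.
have -> : @ref_simplex R n =
  [set t : 'rV[R]_n | forall i, `[0, +oo[%classic (t ord0 i)] `&`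
    (fun t : 'rV[R]_n => \sum_i t ord0 i) @^-1` `]-oo, 1]%classic.
  apply/seteqP; split => t /=.
    by move=> [t0 t1]; split => [i|]; rewrite in_itv/= ?andbT.
  by move=> [t0]; rewrite in_itv/= => t1; split => // i; have := t0 i;
    rewrite in_itv/= andbT.
apply: measurableI;
  first by apply: (@measurable_box _ _ (fun=> `[0, +oo[%classic)).
rewrite -[X in measurable X]setTI; apply: continuous_measurable_rV => //.
by apply: continuous_sum_fun => i; exact: coord_continuous.
Qed.

Lemma continuous_facet_chart F : continuous (@facet_chart R n M F).
Proof.
apply: continuous_rV => i; under eq_fun do rewrite mxE.
apply: continuous_addf; first exact: cst_continuous.
move=> t; apply: (continuous_comp (f := fun t : 'rV[R]_n => t *m facet_edges F)
  (g := fun y : E => y ord0 i)); first exact: continuous_mulmx_rV.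
exact: coord_continuous.
Qed.

Lemma continuous_comp_facet_chart F (w : E -> R) : continuous w ->
  continuous (w \o @facet_chart R n M F).
Proof.
move=> cw t; apply: (continuous_comp (f := @facet_chart R n M F) (g := w)).
  exact: continuous_facet_chart.
exact: cw.
Qed.

Lemma trace_inequality T F : #|T| = n.+2 -> affinely_independent T ->
  F \subset T -> #|F| = n.+1 ->
  exists2 C : R, 0 <= C & forall w : E -> R, C1 w ->
    (\int[leb n]_(t in ref_simplex) (w (facet_chart F t) ^+ 2)%:E <=
     C%:E * \int[leb n.+1]_(x in open_simplex T) (h1density w x)%:E)%E.
Proof.
move=> Tn aT FT Fn; have [A [dir [uA Adir frame]]] := facet_frame Tn aT FT Fn.
have del0 : (0 : R) < n.+1%:R^-1 by rewrite invr_gt0.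
have /choice[C hC] : forall j, exists C : R, 0 <= C /\
    forall (b : E) (g : E -> \bar R),
    measurable_fun setT g -> (forall x, (0 <= g x)%E) ->
    (\int[leb n.+1]_x g (b + x *m A j)%R <= C%:E * \int[leb n.+1]_x g x)%E.
  by move=> j; have [C C0 hC] := ge0_integral_affine_le (uA j); exists C.
have /choice[K hK] : forall j, exists K : R, 0 <= K /\
    forall (w : E -> R) x, C1 w ->
    ((w x ^+ 2)%:E <= \int[lebesgue_measure]_(s in `]0%R, (n.+1%:R^-1)%R[)
       (K * h1density w (x + s *: dir j))%:E)%E.
  by move=> j; have [K K0 hK] := sqr_le_integral_line (dir j) del0; exists K.
exists (\sum_j C j * K j).
  by rewrite sumr_ge0// => j _; rewrite mulr_ge0// ?(hC j).1 ?(hK j).1.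
move=> w Cw.
(* Extension by zero outside T lets the whole-space change of variables apply. *)
pose h (x : E) : R := h1density w x * \1_(open_simplex T) x.
have h0 x : 0 <= h x by rewrite mulr_ge0 ?h1density_ge0.
have mT : measurable (open_simplex T).
  by apply: open_measurable_rV; exact: open_open_simplex.
have mh : measurable_fun setT h.
  apply: measurable_funM; last exact: measurable_indic.
  by apply: continuous_measurable_rV; exact: continuous_h1density.
have -> : (\int[leb n.+1]_(x in open_simplex T) (h1density w x)%:E =
           \int[leb n.+1]_x (h x)%:E)%E.
  rewrite integral_mkcond; apply: eq_integral => x _.
  rewrite /h indicE patchE; case: ifPn => _; first by rewrite mulr1.
  by rewrite mulr0.
pose g j (y : E) : \bar R := (K j * h (facet_vertex F 0 + y *m A j))%:E.
have g0 j y : (0 <= g j y)%E by rewrite lee_fin mulr_ge0 ?(hK j).1.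
have mg j : measurable_fun setT (g j).
  apply/measurable_EFinP; apply: measurable_funM; first exact: measurable_cst.
  apply: (measurableT_comp mh); apply: measurable_rVD;
    first exact: measurable_cst.
  by apply: measurable_mulmx_rV; exact: measurable_id.
have mgc j : measurable_fun setT (g j \o @cons_rV R n).
  exact: (measurableT_comp (mg j) (@measurable_cons_rV R n)).
pose G j (t : 'rV[R]_n) : \bar R :=
  (\int[lebesgue_measure]_s g j (cons_rV (s, t)))%E.
have G0 j t : (0 <= G j t)%E by apply: integral_ge0.
have mG j : measurable_fun setT (G j).
  apply: (measurable_fun_fubini_tonelli_G (m1 := lebesgue_measure)
    (g j \o @cons_rV R n)) => //.
  by move=> x; exact: g0.
have mG' : measurable_fun [set: 'rV[R]_n] (fun t => \sum_j G j t)%E.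
  exact: emeasurable_sum.
have mref := measurable_ref_simplex.
(* The admissible direction depends on t; bounding by the sum over all j avoids cutting
   [ref_simplex] into pieces. *)
apply: (@le_trans _ _ (\int[leb n]_(t in ref_simplex) \sum_j G j t)%E).
  apply: ge0_le_integral => //.
  - by move=> t _; rewrite lee_fin sqr_ge0.
  - apply/measurable_EFinP; apply: measurable_funTS;
      apply: continuous_measurable_rV.
    apply: continuous_sqrf; apply: continuous_comp_facet_chart; exact: Cw.1.
  - exact: measurable_funTS.
  - move=> t reft; have [j frj] := frame t reft.
    apply: (@le_trans _ _ (G j t)); last first.
      by rewrite (bigD1 j)//= leeDl// sume_ge0.
    apply: (le_trans ((hK j).2 w (facet_chart F t) Cw)).
    rewrite /G.
    rewrite (eq_integral (fun s => g j (cons_rV (s, t)))); last first.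
      move=> s; rewrite inE/= in_itv/= => sdel.
      rewrite /g Adir /h indicE mem_set ?mulr1//.
      exact: frj.
    apply: ge0_subset_integral => //.
    by apply: (measurableT_comp (mgc j)); exact: measurable_pair2.
apply: (@le_trans _ _ (\int[leb n]_t \sum_j G j t)%E).
  by apply: ge0_subset_integral => //; move=> t _; exact: sume_ge0.
rewrite ge0_integral_sum//.
rewrite -sumEFin ge0_sume_distrl; last first.
  by move=> j _; rewrite lee_fin mulr_ge0// ?(hC j).1 ?(hK j).1.
apply: lee_sum => j _.
rewrite -(integral_leb_cons (mg j) (g0 j)).
apply: (le_trans ((hC j).2 (facet_vertex F 0) (fun y => (K j * h y)%:E) _ _)).
- by apply/measurable_EFinP; exact: measurable_funM.
- by move=> y; rewrite lee_fin mulr_ge0 ?(hK j).1.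
under eq_integral do rewrite EFinM.
rewrite ge0_integralZl_EFin//.
- by rewrite muleA -EFinM.
- by move=> x _; rewrite lee_fin.
- by apply/measurable_EFinP.
- exact: (hK j).1.
Qed.

End trace_inequality.

(** * L2 and Sobolev functions *)

Section L2.
Context {R : realType} {n : nat}.
Local Notation E := 'rV[R]_n.
Implicit Types (D : set E) (f g h : E -> R).

Lemma L2_integrable_mul D f g : measurable D -> L2 D f -> L2 D g ->
  (leb n).-integrable D (EFin \o (fun x => f x * g x)).
Proof.
move=> mD [mf f2] [mg g2].
have isq h : measurable_fun D h ->
  (\int[leb n]_(x in D) (h x ^+ 2)%:E < +oo)%E ->
    (leb n).-integrable D (EFin \o (fun x => h x ^+ 2)).
  move=> mh h2; apply/integrableP;
    split; first exact/measurable_EFinP/measurable_funX.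
  by under eq_integral do rewrite /= ger0_norm ?sqr_ge0//.
apply: (@le_integrable _ _ _ _ _ mD _ (EFin \o (fun x => f x ^+ 2 + g x ^+ 2))).
- exact/measurable_EFinP/measurable_funM.
- move=> x _; rewrite lee_fin normrM [leRHS]ger0_norm ?addr_ge0 ?sqr_ge0//.
  rewrite -(real_normK (num_real (f x))) -(real_normK (num_real (g x))).
  have := sqr_ge0 (`|f x| - `|g x|); have := sqr_ge0 (`|f x| + `|g x|); lra.
- by have := integrableD mD (isq _ mf f2) (isq _ mg g2); exact.
Qed.

Lemma L2P D f : measurable_fun D f ->
  (leb n).-integrable D (EFin \o (fun x => f x * f x)) -> L2 D f.
Proof.
move=> mf /integrableP[_ h]; split => //; apply: le_lt_trans h.
rewrite le_eqVlt; apply/orP; left; apply/eqP; apply: eq_integral => x _.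
by rewrite /= ger0_norm// -expr2 sqr_ge0.
Qed.

(** Finiteness makes [fine] harmless, so monotonicity of extended integrals carries over to
    [l2dot]. *)
Lemma L2_sqr_integral D f : measurable D -> L2 D f ->
  ((l2dot D f f)%:E = \int[leb n]_(x in D) (f x ^+ 2)%:E)%E.
Proof.
move=> mD f2; rewrite /l2dot /Rintegral fineK//.
by apply: integrable_fin_num => //; exact: L2_integrable_mul.
Qed.

Lemma L2_lin D (c : R) f g : measurable D -> L2 D f -> L2 D g ->
  L2 D (fun x => c * f x + g x).
Proof.
move=> mD f2 g2; apply: L2P.
  by apply: measurable_funD;
    [apply: measurable_funM => //; exact: f2.1|exact: g2.1].
have -> : (fun x => (c * f x + g x) * (c * f x + g x)) =
    (fun x => (c ^+ 2 * (f x * f x) + (2 * c * (f x * g x) + g x * g x))).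
  by apply/funext => x; ring.
have iff := L2_integrable_mul mD f2 f2; have ifg := L2_integrable_mul mD f2 g2.
have igg := L2_integrable_mul mD g2 g2.
have i1 := integrableZl mD (c ^+ 2) iff; have i2 := integrableZl mD (2 * c) ifg.
by have := integrableD mD i1 (integrableD mD i2 igg); exact.
Qed.

Lemma L2_0 D : measurable D -> L2 D (fun=> 0).
Proof.
move=> mD; split; first exact: measurable_cst.
by rewrite (eq_integral (cst 0%E)) ?integral0// => x _; rewrite expr0n.
Qed.

Lemma L2B D f g : measurable D -> L2 D f -> L2 D g -> L2 D (fun x => f x - g x).
Proof.
move=> mD f2 g2; have := L2_lin (-1) mD g2 f2.
by under eq_fun do rewrite mulN1r addrC.
Qed.

Lemma L2_subset D D' f : measurable D -> measurable D' -> D' `<=` D ->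
  L2 D f -> L2 D' f.
Proof.
move=> mD mD' DD [mf f2]; split; first exact: (measurable_funS mD).
apply: le_lt_trans f2; apply: ge0_subset_integral => //.
- by apply/measurable_EFinP; exact: measurable_funX.
- by move=> x _; rewrite lee_fin sqr_ge0.
Qed.

Lemma l2dotC D f g : l2dot D f g = l2dot D g f.
Proof. by rewrite /l2dot; apply: eq_Rintegral => x _; rewrite mulrC. Qed.

Lemma l2dot_linl D (c : R) f g h : measurable D -> L2 D f -> L2 D g -> L2 D h ->
  l2dot D (fun x => c * f x + g x) h = c * l2dot D f h + l2dot D g h.
Proof.
move=> mD f2 g2 h2; rewrite /l2dot.
under eq_Rintegral do rewrite mulrDl -mulrA.
have ifh := L2_integrable_mul mD f2 h2.
rewrite RintegralD//;
  [|exact: (integrableZl mD c ifh)|exact: L2_integrable_mul].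
by rewrite RintegralZl.
Qed.

Lemma l2dotBl D f g h : measurable D -> L2 D f -> L2 D g -> L2 D h ->
  l2dot D (fun x => f x - g x) h = l2dot D f h - l2dot D g h.
Proof.
move=> mD f2 g2 h2; rewrite -mulN1r addrC -l2dot_linl//.
by apply: eq_Rintegral => x _; rewrite mulN1r addrC.
Qed.

Lemma l2dot_ge0 D f : 0 <= l2dot D f f.
Proof. by apply: Rintegral_ge0 => x _; rewrite -expr2 sqr_ge0. Qed.

Lemma l2dot_subset D D' f : measurable D -> measurable D' -> D' `<=` D ->
  L2 D f -> l2dot D' f f <= l2dot D f f.
Proof.
move=> mD mD' DD f2; rewrite -lee_fin !L2_sqr_integral//;
  last exact: L2_subset f2.
apply: ge0_subset_integral => //.
- by apply/measurable_EFinP; apply: measurable_funX; exact: f2.1.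
- by move=> x _; rewrite lee_fin sqr_ge0.
Qed.

(** Pointwise (a + b)^2 <= 2 a^2 + 2 b^2; working with squares keeps square roots out of the trace
    estimates. *)
Lemma l2dot_triangle D f g h : measurable D -> L2 D f -> L2 D g -> L2 D h ->
  l2dot D (fun x => f x - g x) (fun x => f x - g x) <=
  2 * l2dot D (fun x => f x - h x) (fun x => f x - h x) +
  2 * l2dot D (fun x => h x - g x) (fun x => h x - g x).
Proof.
move=> mD f2 g2 h2.
have ifh := L2_integrable_mul mD (L2B mD f2 h2) (L2B mD f2 h2).
have ihg := L2_integrable_mul mD (L2B mD h2 g2) (L2B mD h2 g2).
have i1 := integrableZl mD 2 ifh; have i2 := integrableZl mD 2 ihg.
rewrite /l2dot -!RintegralZl// -RintegralD//.
apply: le_Rintegral => //.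
- by apply: L2_integrable_mul => //; exact: L2B.
- exact: (integrableD mD i1 i2).
by move=> x _; have := sqr_ge0 ((f x - h x) - (h x - g x)); lra.
Qed.

Lemma l2dot_ae0 D f g : measurable D -> L2 D f -> L2 D g ->
  l2dot D f f = 0 -> l2dot D f g = 0.
Proof.
move=> mD f2 g2 f0.
have f_ae0 : {ae leb n, forall x, D x -> (f x ^+ 2)%:E = 0%E :> \bar R}.
  have mff : measurable_fun D (fun x => (f x ^+ 2)%:E : \bar R).
    by apply/measurable_EFinP; apply: measurable_funX; exact: f2.1.
  apply/(ae_eq_integral_abs (leb n) mD mff).
  transitivity (\int[leb n]_(x in D) (f x ^+ 2)%:E)%E.
    by apply: eq_integral => x _; rewrite /= ger0_norm// sqr_ge0.
  by rewrite -L2_sqr_integral// f0.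
rewrite /l2dot /Rintegral (ae_eq_integral (cst 0%E))//.
- by rewrite integral0.
- by apply/measurable_EFinP; apply: measurable_funM; [exact: f2.1|exact: g2.1].
- apply: filterS f_ae0 => x + Dx => /(_ Dx)[/eqP]; rewrite sqrf_eq0 => /eqP ->.
  by rewrite mul0r.
Qed.

Lemma eq_ae_l2dot D f g h : measurable D -> L2 D f -> L2 D g -> L2 D h ->
  ae_on D (fun x => f x = g x) -> l2dot D f h = l2dot D g h.
Proof.
move=> mD f2 g2 h2 fg; rewrite /l2dot /Rintegral; congr fine.
apply: ae_eq_integral => //.
- by apply/measurable_EFinP; apply: measurable_funM; [exact: f2.1|exact: h2.1].
- by apply/measurable_EFinP; apply: measurable_funM; [exact: g2.1|exact: h2.1].
- by move: fg; rewrite /ae_on; apply: filterS => x + Dx => /(_ Dx) ->.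
Qed.

Lemma cube_compact c : compact (@cube R n c).
Proof.
apply: (@rV_compact _ _ (fun=> `[- c, c]%classic)) => _; exact: segment_compact.
Qed.

Lemma continuous_L2 D (c : R) f : 0 <= c -> measurable D ->
  D `<=` @cube R n c ->
  continuous f -> L2 D f.
Proof.
move=> c0 mD Dc cf.
have mf : measurable_fun setT f by exact: continuous_measurable_rV.
split; first exact: measurable_funTS.
have [|||y _ ymax] := @EVT_max_rV R n (fun x => f x ^+ 2) (@cube R n c).
- by exists 0 => i /=; rewrite mxE in_itv/= oppr_le0 c0.
- exact: cube_compact.
- by apply: continuous_subspaceT; exact: continuous_sqrf.
have mc := @measurable_cube R n c.
apply: (@le_lt_trans _ _ (\int[leb n]_(x in @cube R n c) (f y ^+ 2)%:E)%E).
  apply: (@le_trans _ _ (\int[leb n]_(x in @cube R n c) (f x ^+ 2)%:E)%E).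
    apply: ge0_subset_integral => //.
    - by apply/measurable_EFinP; apply: measurable_funX;
        exact: measurable_funTS.
    - by move=> x _; rewrite lee_fin sqr_ge0.
  apply: ge0_le_integral => //.
  - by move=> x _; rewrite lee_fin sqr_ge0.
  - by apply/measurable_EFinP; apply: measurable_funX; exact: measurable_funTS.
  - by move=> x xc; rewrite lee_fin ymax// inE.
rewrite integral_cst// [X in (_ * X)%E](leb_cube n c0) -EFinM ltry//.
Qed.

Lemma bounded_set_cube D : bounded_set D ->
  exists2 c, 0 <= c & D `<=` @cube R n c.
Proof.
move=> [m [_ Dm]]; exists (`|m| + 1); first by rewrite addr_ge0.
move=> x Dx i /=; rewrite in_itv/= -ler_norml.
apply: le_trans (Dm (`|m| + 1) _ _ Dx); last by rewrite ltr_pwDr// ler_norm.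
rewrite [leRHS]/Num.norm/= mx_normrE; apply/bigmax_geP; right => /=.
by exists (ord0, i).
Qed.

End L2.

(** * Dirichlet form and H^1 distance *)

Section sobolev_facts.
Context {R : realType} {n : nat}.
Local Notation E := 'rV[R]_n.
Implicit Types (D : set E) (v w : sobolev R n).

Lemma smooth_C1 (f : E -> R) : smooth f -> C1 f.
Proof.
move=> sf; split; first exact: (sf [::]).1.
by move=> i; split; [exact: (sf [::]).2|exact: (sf [:: i]).1].
Qed.

(** [H1] without the link between function and gradient: the calculus of the Dirichlet form uses
    integrability alone, which is stable under linear combinations. *)
Definition sobolev_L2 D v : Prop :=
  L2 D v.1 /\ forall i : 'I_n, L2 D (fun x => v.2 x ord0 i).

Lemma sobolev_L2_lin D (c : R) v w : measurable D -> sobolev_L2 D v ->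
  sobolev_L2 D w ->
  sobolev_L2 D (c *: v + w).
Proof.
move=> mD [v1 v2] [w1 w2]; split; first exact: (L2_lin c mD v1 w1).
move=> i; have := L2_lin c mD (v2 i) (w2 i).
by congr L2; apply/funext => x; rewrite !mxE.
Qed.

Lemma sobolev_L2B D v w : measurable D -> sobolev_L2 D v -> sobolev_L2 D w ->
  sobolev_L2 D (v - w).
Proof.
by move=> mD vL wL; rewrite -scaleN1r addrC; exact: sobolev_L2_lin.
Qed.

Lemma sobolev_L2_subset D D' v : measurable D -> measurable D' -> D' `<=` D ->
  sobolev_L2 D v -> sobolev_L2 D' v.
Proof.
by move=> mD mD' DD [v1 v2]; split => [|i]; apply: (L2_subset mD mD' DD).
Qed.

Lemma smooth_sobolev_L2 D (c : R) (f : E -> R) : 0 <= c -> measurable D ->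
  D `<=` @cube R n c -> smooth f -> sobolev_L2 D (sob_of_smooth f).
Proof.
move=> c0 mD Dc /smooth_C1[cf df];
  split; first exact: (continuous_L2 c0 mD Dc cf).
move=> i; have := continuous_L2 c0 mD Dc (df i).2.
by congr L2; apply/funext => x; rewrite mxE.
Qed.

Lemma dirichlet_integrable D v w : measurable D -> sobolev_L2 D v ->
  sobolev_L2 D w ->
  (leb n).-integrable D (EFin \o (fun x => dotv (v.2 x) (w.2 x))).
Proof.
move=> mD [_ v2] [_ w2].
have -> : EFin \o (fun x => dotv (v.2 x) (w.2 x)) =
    (fun x => \sum_i ((v.2 x ord0 i * w.2 x ord0 i)%:E : \bar R))%E.
  by apply/funext => x; rewrite /= sumEFin.
apply: integrable_sum => //= i _.
exact: (L2_integrable_mul mD (v2 i) (w2 i)).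
Qed.

Lemma dirichletE D v w : measurable D -> sobolev_L2 D v -> sobolev_L2 D w ->
  dirichlet D v w =
    \sum_i l2dot D (fun x => v.2 x ord0 i) (fun x => w.2 x ord0 i).
Proof.
move=> mD [_ v2] [_ w2]; rewrite /dirichlet /dotv /l2dot.
elim: (index_enum _) => [|i s ih].
  rewrite big_nil /Rintegral; under eq_integral do rewrite big_nil.
  by rewrite integral0.
rewrite big_cons -ih -RintegralD//.
- by apply: eq_Rintegral => x _; rewrite big_cons.
- exact: (L2_integrable_mul mD (v2 i) (w2 i)).
- have -> : EFin \o (fun x => \sum_(j <- s) v.2 x ord0 j * w.2 x ord0 j) =
      (fun x => \sum_(j <- s) ((v.2 x ord0 j * w.2 x ord0 j)%:E : \bar R))%E.
    by apply/funext => x; rewrite /= sumEFin.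
  by apply: integrable_sum => //= j _;
    exact: (L2_integrable_mul mD (v2 j) (w2 j)).
Qed.

Lemma dirichlet_ge0 D v : 0 <= dirichlet D v v.
Proof.
apply: Rintegral_ge0 => x _; rewrite /dotv sumr_ge0// => i _.
by rewrite -expr2 sqr_ge0.
Qed.

Lemma h1semi_sqr D v : h1semi D v ^+ 2 = dirichlet D v v.
Proof. by rewrite sqr_sqrtr// dirichlet_ge0. Qed.

Lemma h1semi_ge0 D v : 0 <= h1semi D v.
Proof. exact: sqrtr_ge0. Qed.

Lemma dirichletC D v w : dirichlet D v w = dirichlet D w v.
Proof.
rewrite /dirichlet; apply: eq_Rintegral => x _.
by apply: eq_bigr => i _; rewrite mulrC.
Qed.

Lemma dirichlet_linr D (c : R) u v w : measurable D ->
  sobolev_L2 D u -> sobolev_L2 D v -> sobolev_L2 D w ->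
  dirichlet D u (c *: v + w) = c * dirichlet D u v + dirichlet D u w.
Proof.
move=> mD uL vL wL; rewrite !dirichletE//; last exact: sobolev_L2_lin.
rewrite mulr_sumr -big_split/=; apply: eq_bigr => i _.
rewrite !(l2dotC D (fun x => u.2 x ord0 i)) -l2dot_linl//.
- by congr l2dot; apply/funext => x; rewrite !mxE.
- exact: vL.2.
- exact: wL.2.
- exact: uL.2.
Qed.

Lemma dirichletBr D u v w : measurable D ->
  sobolev_L2 D u -> sobolev_L2 D v -> sobolev_L2 D w ->
  dirichlet D u (v - w) = dirichlet D u v - dirichlet D u w.
Proof.
move=> mD uL vL wL; rewrite -scaleN1r addrC dirichlet_linr//; ring.
Qed.

Lemma dirichlet_h1semi0 D u v : measurable D -> sobolev_L2 D u ->
  sobolev_L2 D v ->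
  h1semi D v = 0 -> dirichlet D u v = 0.
Proof.
move=> mD uL vL v0; have := h1semi_sqr D v;
  rewrite v0 expr0n/= dirichletE// => /esym/eqP.
rewrite psumr_eq0; last by move=> i _; exact: l2dot_ge0.
move=> /allP vi0; rewrite dirichletC dirichletE// big1// => i _.
apply: l2dot_ae0 => //; [exact: vL.2|exact: uL.2|].
by apply/eqP/(vi0 i); rewrite mem_index_enum.
Qed.

Lemma eq_sob_dirichlet D u v w : measurable D ->
  sobolev_L2 D u -> sobolev_L2 D v -> sobolev_L2 D w ->
  sob_eq D v w -> dirichlet D u v = dirichlet D u w.
Proof.
move=> mD uL vL wL vw; rewrite !(dirichletC D u) !dirichletE//.
apply: eq_bigr => i _; apply: eq_ae_l2dot => //;
  [exact: vL.2|exact: wL.2|exact: uL.2|].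
by move: vw; rewrite /sob_eq /ae_on; apply: filterS => x + Dx => /(_ Dx)[_ ->].
Qed.

(** Squared H^1 distance, split into scalar components so that the L2 lemmas apply term by term. *)
Definition h1dist2 D v w : R :=
  l2dot D (fun x => v.1 x - w.1 x) (fun x => v.1 x - w.1 x) +
  \sum_i l2dot D (fun x => v.2 x ord0 i - w.2 x ord0 i)
                 (fun x => v.2 x ord0 i - w.2 x ord0 i).

Lemma h1norm_ge0 D v : 0 <= h1norm D v.
Proof. exact: sqrtr_ge0. Qed.

Lemma h1norm_subE D v w : measurable D -> sobolev_L2 D v -> sobolev_L2 D w ->
  h1norm D (v - w) ^+ 2 = h1dist2 D v w.
Proof.
move=> mD vL wL; rewrite sqr_sqrtr;
  last by rewrite addr_ge0 ?l2dot_ge0 ?dirichlet_ge0.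
rewrite dirichletE//; [|exact: sobolev_L2B..].
congr (_ + _); apply: eq_bigr => i _.
by congr l2dot; apply/funext => x; rewrite !mxE.
Qed.

Lemma h1dist2_subset D D' v w : measurable D -> measurable D' -> D' `<=` D ->
  sobolev_L2 D v -> sobolev_L2 D w -> h1dist2 D' v w <= h1dist2 D v w.
Proof.
move=> mD mD' DD [v1 v2] [w1 w2]; apply: lerD.
  by apply: l2dot_subset => //; exact: L2B.
by apply: ler_sum => i _; apply: l2dot_subset => //; exact: L2B.
Qed.

Lemma h1norm_subset D D' v w : measurable D -> measurable D' -> D' `<=` D ->
  sobolev_L2 D v -> sobolev_L2 D w -> h1norm D' (v - w) <= h1norm D (v - w).
Proof.
move=> mD mD' DD vL wL; rewrite -ler_sqr ?nnegrE ?h1norm_ge0//.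
rewrite !h1norm_subE//;
  [exact: h1dist2_subset|exact: sobolev_L2_subset vL|
   exact: sobolev_L2_subset wL].
Qed.

Lemma h1dist2_triangle D u v w : measurable D ->
  sobolev_L2 D u -> sobolev_L2 D v -> sobolev_L2 D w ->
  h1dist2 D u v <= 2 * h1dist2 D u w + 2 * h1dist2 D v w.
Proof.
move=> mD [u1 u2] [v1 v2] [w1 w2].
have opp (f g : E -> R) : l2dot D (fun x => f x - g x) (fun x => f x - g x) =
    l2dot D (fun x => g x - f x) (fun x => g x - f x).
  by apply: eq_Rintegral => x _; ring.
rewrite /h1dist2 !mulrDr addrACA !mulr_sumr -big_split/=; apply: lerD.
  by rewrite (opp v.1); exact: l2dot_triangle.
apply: ler_sum => i _; rewrite (opp (fun x => v.2 x ord0 i)).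
exact: (l2dot_triangle mD (u2 i) (v2 i) (w2 i)).
Qed.

Lemma integral_h1density D (f g : E -> R) : measurable D -> C1 f -> C1 g ->
  sobolev_L2 D (sob_of_smooth f) -> sobolev_L2 D (sob_of_smooth g) ->
  (\int[leb n]_(x in D) (h1density (fun y => f y - g y) x)%:E =
   (h1dist2 D (sob_of_smooth f) (sob_of_smooth g))%:E)%E.
Proof.
move=> mD Cf Cg fL gL.
have fgL := sobolev_L2B mD fL gL.
rewrite -h1norm_subE// sqr_sqrtr;
  last by rewrite addr_ge0 ?l2dot_ge0 ?dirichlet_ge0.
have i1 := L2_integrable_mul mD fgL.1 fgL.1.
have i2 := dirichlet_integrable mD fgL fgL.
rewrite /l2dot /dirichlet -RintegralD// /Rintegral fineK; last first.
  by apply: integrable_fin_num => //; exact: (integrableD mD i1 i2).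
apply: eq_integral => x _; congr EFin; congr (_ + _).
apply: eq_bigr => i _; rewrite !mxE -expr2; congr (_ ^+ 2).
rewrite -[LHS]/('D_('e_i) (f - g) x) deriveB//;
  [exact: (Cf.2 i).1|exact: (Cg.2 i).1].
Qed.

Lemma C1B (f g : E -> R) : C1 f -> C1 g -> C1 (fun x => f x - g x).
Proof.
move=> [cf df] [cg dg]; split.
  by move=> x; apply: (continuousB (f := f)); [exact: cf|exact: cg].
move=> i; split => [x|].
  by apply: (derivableB (f := f)); [exact: (df i).1|exact: (dg i).1].
have -> : 'D_('e_i) (fun x => f x - g x) =
  (fun x => 'D_('e_i) f x - 'D_('e_i) g x).
  by apply/funext => x; apply: (deriveB (f := f));
    [exact: (df i).1|exact: (dg i).1].
move=> x; apply: (continuousB (f := 'D_('e_i) f));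
  [exact: (df i).2|exact: (dg i).2].
Qed.

End sobolev_facts.

(** * Traces of H10 functions on facets *)

Section traces.
Context {R : realType} {n : nat} (M : mesh R n).
Local Notation E := 'rV[R]_n.+1.
Local Notation vert := (vertex M).
Implicit Types (S T F : {set vert}) (v : sobolev R n.+1) (a b : E -> R).

Definition facet_density F : R :=
  Num.sqrt (\det (facet_edges F *m (facet_edges F)^T)).

Lemma facet_density_ge0 F : 0 <= facet_density F.
Proof. exact: sqrtr_ge0. Qed.

Lemma facet_integral_sub F a b :
  facet_integral F (fun x => (a x - b x) ^+ 2) = facet_density F *
    l2dot ref_simplex (fun t => a (facet_chart F t) - b (facet_chart F t))
                      (fun t => a (facet_chart F t) - b (facet_chart F t)).
Proof. by congr (_ * _); apply: eq_Rintegral => t _; rewrite expr2. Qed.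

Lemma ref_simplex_sub_cube : @ref_simplex R n `<=` @cube R n 1.
Proof.
move=> t [t0 t1] i /=; rewrite in_itv/= (le_trans _ (t0 i)) ?lerN10//=.
apply: le_trans t1; rewrite (bigD1 i)//= lerDl sumr_ge0// => j _; exact: t0.
Qed.

Lemma continuous_facet_L2 F a : continuous a ->
  L2 ref_simplex (fun t => a (facet_chart F t)).
Proof.
move=> ca; apply: (continuous_L2 ler01 measurable_ref_simplex
  ref_simplex_sub_cube).
exact: continuous_comp_facet_chart.
Qed.

(** The trace inequality is available for smooth functions only, so it is applied to a - b, and v
    enters through the triangle inequality, which contributes the factor 2. *)
Lemma facet_integral_le T F (c : R) : #|T| = n.+2 -> affinely_independent T ->
  F \subset T -> #|F| = n.+1 -> 0 <= c -> open_simplex T `<=` @cube R n.+1 c ->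
  exists2 C : R, 0 <= C & forall a b v, smooth a -> smooth b ->
    sobolev_L2 (open_simplex T) v ->
    facet_integral F (fun x => (a x - b x) ^+ 2) <=
    C * (h1norm (open_simplex T) (sob_of_smooth a - v) ^+ 2 +
         h1norm (open_simplex T) (sob_of_smooth b - v) ^+ 2).
Proof.
move=> Tn aT FT Fn c0 Tc; have [C C0 hC] := trace_inequality Tn aT FT Fn.
exists (facet_density F * (2 * C)).
  by rewrite !mulr_ge0// facet_density_ge0.
move=> a b v sa sb vL.
have mT : measurable (open_simplex T).
  by apply: open_measurable_rV; exact: open_open_simplex.
have aL := smooth_sobolev_L2 c0 mT Tc sa;
  have bL := smooth_sobolev_L2 c0 mT Tc sb.
have Ca := smooth_C1 sa; have Cb := smooth_C1 sb.
rewrite facet_integral_sub -mulrA ler_wpM2l ?facet_density_ge0//.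
have la := continuous_facet_L2 F Ca.1; have lb := continuous_facet_L2 F Cb.1.
have mref := @measurable_ref_simplex R n.
have lab := L2B mref la lb.
have tri := h1dist2_triangle mT aL bL vL.
rewrite -(h1norm_subE mT aL vL) -(h1norm_subE mT bL vL) in tri.
have h : (l2dot ref_simplex (fun t => a (facet_chart F t) - b (facet_chart F t))
    (fun t => a (facet_chart F t) - b (facet_chart F t)) <=
    C * h1dist2 (open_simplex T) (sob_of_smooth a) (sob_of_smooth b)).
  rewrite -lee_fin (L2_sqr_integral mref lab)
    EFinM -(integral_h1density mT Ca Cb aL bL).
  exact: (hC _ (C1B Ca Cb)).
apply: (le_trans h); rewrite (mulrC 2) -mulrA ler_wpM2l// mulrDr.
exact: tri.
Qed.

Lemma is_traceE T F (c : R) v (chi : nat -> E -> R) :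
  #|T| = n.+2 -> affinely_independent T ->
  F \subset T -> #|F| = n.+1 -> 0 <= c -> open_simplex T `<=` @cube R n.+1 c ->
  sobolev_L2 (open_simplex T) v -> (forall k, smooth (chi k)) ->
  h1norm (open_simplex T) (sob_of_smooth (chi k) - v) @[k --> \oo] -->
    (0 : R) ->
  [set g | is_trace T F v g] = [set g | L2_facet F g /\
    facet_integral F (fun x => (chi k x - g x) ^+ 2) @[k --> \oo] --> (0 : R)].
Proof.
move=> Tn aT FT Fn c0 Tc vL schi chiv; apply/seteqP; split => g /=; last first.
  by move=> [g2 chig]; split => //; exists chi.
move=> [g2 [phi [sphi phiv phig]]]; split => //.
have [C C0 hC] := facet_integral_le Tn aT FT Fn c0 Tc.
have mref := @measurable_ref_simplex R n.
have gL : L2 ref_simplex (fun t => g (facet_chart F t)) := g2.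
(* The triangle inequality through phi k: [facet_integral_le] bounds the distance from chi k to phi
   k, and phi k tends to g by assumption. *)
apply: (@squeeze_cvgr _ _ _ _ (fun=> 0) (fun k =>
  2 * (C * (h1norm (open_simplex T) (sob_of_smooth (chi k) - v) ^+ 2 +
       h1norm (open_simplex T) (sob_of_smooth (phi k) - v) ^+ 2)) +
  2 * facet_integral F (fun x => (phi k x - g x) ^+ 2))).
- near=> k; apply/andP; split.
    by rewrite facet_integral_sub mulr_ge0 ?facet_density_ge0 ?l2dot_ge0.
  have := hC _ _ _ (schi k) (sphi k) vL; rewrite !facet_integral_sub => h.
  have lchi := continuous_facet_L2 F (smooth_C1 (schi k)).1.
  have lphi := continuous_facet_L2 F (smooth_C1 (sphi k)).1.
  have := ler_wpM2l (facet_density_ge0 F) (l2dot_triangle mref lchi gL lphi).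
  rewrite mulrDr !(mulrCA _ 2) => /le_trans; apply.
  by rewrite lerD2r ler_wpM2l.
- exact: cvg_cst.
- have sqr0 (s : nat -> R) : s k @[k --> \oo] --> (0 : R) ->
      s k ^+ 2 @[k --> \oo] --> (0 : R).
    move=> s0; have -> : (0 : R) = 0 * 0 by rewrite mulr0.
    exact: (cvgM s0 s0).
  have -> : (0 : R) = 2 * (C * (0 + 0)) + 2 * 0 by ring.
  apply: cvgD; last by apply: cvgM => //; exact: cvg_cst.
  apply: cvgM; first exact: cvg_cst.
  apply: cvgM; first exact: cvg_cst.
  exact: (cvgD (sqr0 _ chiv) (sqr0 _ phiv)).
Unshelve. all: by end_near.
Qed.

Lemma H10_sobolev_L2 D v : H10 D v -> sobolev_L2 D v.
Proof. by move=> [[v1 v2 _] _]. Qed.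

Section mesh_facts.
Variables (Om : set E) (sigma : R).
Hypotheses (MT : triangulation M Om sigma) (oOm : open Om)
  (bOm : bounded_set Om).

Lemma cell_measurable T : T \in cells M -> measurable (open_simplex T).
Proof.
move=> TM; have [cM _ _ _ _] := MT; have [Tn aT] := cM _ TM.
by apply: open_measurable_rV; exact: open_open_simplex.
Qed.

Lemma cell_sub T : T \in cells M -> open_simplex T `<=` Om.
Proof. by have [_ _ _ h _] := MT; exact: h. Qed.

(** One sequence serves all cells and facets, and the right-hand set does not mention T:
    neighbouring cells thus have the same set of traces on their common facet. *)
Lemma H10_is_trace v : H10 Om v -> exists chi : nat -> E -> R,
  (forall k, test_function Om (chi k)) /\
  forall T F, T \in cells M -> F \subset T -> #|F| = n.+1 ->
  [set g | is_trace T F v g] = [set g | L2_facet F g /\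
    facet_integral F (fun x => (chi k x - g x) ^+ 2) @[k --> \oo] --> (0 : R)].
Proof.
move=> vH; have vL := H10_sobolev_L2 vH; have [_ [chi [tchi chiv]]] := vH.
have mOm := open_measurable_rV oOm.
exists chi; split => // T F TM FT Fn.
have [c c0 Omc] := bounded_set_cube bOm.
have [cM _ _ _ _] := MT; have [Tn aT] := cM _ TM.
have mT := cell_measurable TM; have TOm := cell_sub TM.
have schi k : smooth (chi k) by exact: (tchi k).1.
apply: (is_traceE (c := c)) => //.
- exact: subset_trans Omc.
- exact: sobolev_L2_subset vL.
apply: (@squeeze_cvgr _ _ _ _ (fun=> 0)
  (fun k => h1norm Om (sob_of_smooth (chi k) - v))) => //.
- near=> k; rewrite h1norm_ge0/=; apply: h1norm_subset => //.
  exact: (smooth_sobolev_L2 c0 mOm Omc).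
- exact: cvg_cst.
Unshelve. all: by end_near.
Qed.

Lemma interior_jump0 F v x : H10 Om v -> F \in interior_facets M ->
  jump F v x = 0.
Proof.
move=> /H10_is_trace[chi [_ trE]]; rewrite inE => /andP[/eqP Fn /eqP F2].
have cE T : (T \in enum (cells_at F)) = (T \in cells M) && (F \subset T).
  by rewrite mem_enum inE.
rewrite /jump; case eF : (enum (cells_at F)) => [//|T1 [|T2 [|//]]].
  by move: F2; rewrite cardE eF.
have /andP[T1M FT1] : (T1 \in cells M) && (F \subset T1)
  by rewrite -cE eF inE eqxx.
have /andP[T2M FT2] : (T2 \in cells M) && (F \subset T2)
  by rewrite -cE eF !inE eqxx orbT.
by rewrite /trace (trE T1)// (trE T2)// subrr.
Qed.

Lemma boundary_jump0 F v : H10 Om v -> F \in boundary_facets M ->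
  facet_integral F (fun x => jump F v x ^+ 2) = 0.
Proof.
move=> /H10_is_trace[chi [tchi trE]]; rewrite inE => /andP[/eqP Fn /eqP F1].
have cE T : (T \in enum (cells_at F)) = (T \in cells M) && (F \subset T).
  by rewrite mem_enum inE.
rewrite /jump; case eF : (enum (cells_at F)) => [|T [|? ?]].
- by move: F1; rewrite cardE eF.
- have /andP[TM FT] : (T \in cells M) && (F \subset T)
    by rewrite -cE eF inE eqxx.
  have Fout x : simplex F x -> ~ Om x.
    apply: (boundary_facet_disjoint MT oOm TM FT Fn) => T' T'M FT'.
    have : T' \in enum (cells_at F) by rewrite cE T'M.
    by rewrite eF inE => /eqP.
  have chi0 k t : ref_simplex t -> chi k (facet_chart F t) = 0.
    move=> reft; have [_ [K [_ KOm K0]]] := tchi k.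
    by apply: K0 => /KOm; apply: Fout; exact: facet_chart_simplex.
  have int0 (g : E -> R) k : facet_integral F (fun x => (chi k x - g x) ^+ 2) =
      facet_integral F (fun x => g x ^+ 2).
    congr (_ * _); apply: eq_Rintegral => t; rewrite inE => reft.
    by rewrite chi0// sub0r sqrrN.
  (* Since chi k vanishes on F, a trace g makes the constant sequence of the integrals of g^2 tend
     to 0; failing any trace, the default is 0. *)
  rewrite /trace trE//; case: xgetP => [g _ /= [_ +]|_].
    under eq_fun do rewrite int0.
    move=> g0; apply: (cvg_unique (@norm_hausdorff _ _) _ g0); exact: cvg_cst.
  rewrite /facet_integral; under eq_Rintegral do rewrite expr0n.
  by rewrite /Rintegral integral0 mulr0.
- by move: F1; rewrite cardE eF.
Qed.

Lemma sum_cells_h1semi v : sobolev_L2 Om v ->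
  \sum_(T in cells M) h1semi (open_simplex T) v ^+ 2 <= h1semi Om v ^+ 2.
Proof.
move=> vL; have mOm := open_measurable_rV oOm.
under eq_bigr do rewrite h1semi_sqr.
rewrite h1semi_sqr -lee_fin -sumEFin.
pose d x : \bar R := (dotv (v.2 x) (v.2 x))%:E.
have d0 x : (0 <= d x)%E.
  by rewrite lee_fin /dotv sumr_ge0// => i _; rewrite -expr2 sqr_ge0.
have dE D : measurable D -> D `<=` Om ->
  ((dirichlet D v v)%:E = \int[leb n.+1]_(x in D) d x)%E.
  move=> mD DOm; have vD := sobolev_L2_subset mOm mD DOm vL.
  rewrite /dirichlet /Rintegral fineK//.
  by apply: integrable_fin_num => //; exact: dirichlet_integrable.
(* The value [set0] off the mesh makes measurability and inclusion in [Om] hold for every T. *)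
pose S T := if T \in cells M then open_simplex T else set0.
have mS T : measurable (S T) by rewrite /S; case: ifP => // TM;
  exact: cell_measurable.
have SOm T : S T `<=` Om by rewrite /S; case: ifP => [TM|_];
  [exact: cell_sub|exact: sub0set].
have md : measurable_fun Om d.
  by have /integrableP[] := dirichlet_integrable mOm vL vL.
rewrite (eq_bigr (fun T => \int[leb n.+1]_(x in S T) d x)%E); last first.
  by move=> T TM; rewrite dE /S ?TM//; [exact: cell_measurable|exact: cell_sub].
rewrite -big_enum/=.
have sU : \big[setU/set0]_(T <- enum (cells M)) S T `<=` Om.
  by rewrite -bigcup_seq => x [T _]; exact: SOm.
rewrite -ge0_integral_bigsetU//.
- by rewrite dE//; apply: ge0_subset_integral => //; exact: bigsetU_measurable.
- exact: enum_uniq.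
- move=> T T' /=; rewrite !mem_enum => TM T'M; rewrite /S TM T'M.
  exact: (trivIset_open_simplex MT).
- exact: measurable_funS md.
Qed.

Lemma dgnorm_le_h1semi v : H10 Om v -> dgnorm M v <= h1semi Om v.
Proof.
move=> vH; have vL := H10_sobolev_L2 vH.
rewrite -(ger0_norm (h1semi_ge0 Om v)) -sqrtr_sqr; apply: ler_wsqrtr.
rewrite [X in _ + X]big1 ?addr0; first exact: sum_cells_h1semi.
move=> F; rewrite inE => /orP[FI|FB]; last by rewrite boundary_jump0// mulr0.
rewrite /facet_integral /Rintegral.
under eq_integral do rewrite (interior_jump0 _ vH FI) expr0n/=.
by rewrite integral0 mulr0 mulr0.
Qed.

End mesh_facts.

End traces.

(** * Broken Sobolev functions, dual norms and the averaging operator *)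

Section broken.
Context {R : realType}.

Lemma l2dot_supported n (D D' : set 'rV[R]_n) (f h : 'rV[R]_n -> R) :
  D' `<=` D ->
  (forall x, ~ D' x -> h x = 0) -> l2dot D' f h = l2dot D f h.
Proof.
move=> DD h0; rewrite /l2dot Rintegral_mkcond [RHS]Rintegral_mkcond.
apply: eq_Rintegral => x _; rewrite !patchE.
have [xD'|xD'] := pselect (D' x).
  by rewrite !mem_set//; exact: DD.
by rewrite h0// !mulr0 !if_same.
Qed.

Lemma test_function_derive0 n (D : set 'rV[R]_n) (f : 'rV[R]_n -> R) e x :
  test_function D f -> ~ D x -> 'D_e f x = 0.
Proof.
move=> [_ [K [cK KD K0]]] Dx.
have oK : open (~` K) by rewrite openC; apply: compact_closed => //;
  exact: norm_hausdorff.
rewrite -[RHS](derive_cst (0 : R) x e); apply: near_eq_derive.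
have : nbhs x (~` K) by apply: open_nbhs_nbhs; split => // /KD.
by apply: filterS => y /K0.
Qed.

(** A test function on the smaller set is one on the larger, and it vanishes with its derivatives
    off the smaller set, so both integrals are unchanged. *)
Lemma H1_subset n (D D' : set 'rV[R]_n) (v : sobolev R n) :
  measurable D -> measurable D' -> D' `<=` D -> H1 D v -> H1 D' v.
Proof.
move=> mD mD' DD [v1 v2 wg]; split.
- exact: (L2_subset mD mD' DD).
- by move=> i; exact: (L2_subset mD mD' DD).
move=> f tf i; have tf' : test_function D f.
  by case: tf => sf [K [cK KD K0]]; split => //; exists K; split => //;
    exact: subset_trans KD DD.
rewrite (l2dot_supported _ DD); last by move=> x; exact: test_function_derive0.
rewrite (l2dot_supported _ DD); first exact: wg.
by case: tf => _ [K [_ KD K0]] x Dx; apply: K0 => /KD.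
Qed.

Lemma H10_broken_H1 n (M : mesh R n) (Om : set 'rV[R]_n.+1) sigma v :
  triangulation M Om sigma -> open Om -> H10 Om v -> broken_H1 M Om v.
Proof.
move=> MT oOm [vH1 _]; have mOm := open_measurable_rV oOm.
split; first by case: vH1.
move=> T TM; apply: (H1_subset mOm) => //; first exact: (cell_measurable MT).
exact: (cell_sub MT).
Qed.

(** Rescaling to the unit ball. The supremum may be [+oo] at this stage, hence the extended reals;
    for z = 0 the convention 0 * +oo = 0 applies. *)
Lemma le_dual_norm (V : normedModType R) (ell : V -> R) (z : V) :
  (forall c y, ell (c *: y) = c * ell y) ->
  (`|ell z|%:E <= `|z|%:E * dual_norm ell)%E.
Proof.
move=> ellZ; have [->|z0] := eqVneq z 0.
  by rewrite -(scale0r (0 : V)) ellZ mul0r scale0r !normr0 mul0e.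
have nz0 : 0 < `|z| by rewrite normr_gt0.
rewrite -{1}[z](scalerKV (lt0r_neq0 nz0)) ellZ normrM normr_id EFinM.
apply: lee_wpmul2l; first by rewrite lee_fin.
apply: ereal_sup_ubound; exists (`|z|^-1 *: z) => //=.
by rewrite normrZ normfV normr_id mulVf// gt_eqF.
Qed.

Lemma dual_norm_ge0 (V : normedModType R) (ell : V -> R) :
  (0 <= dual_norm ell)%E.
Proof.
apply: (@le_trans _ _ `|ell 0|%:E); first by rewrite lee_fin.
by apply: ereal_sup_ubound; exists 0 => //=; rewrite normr0.
Qed.

(** * The averaging operator modulo null sets *)

Section averaging.
Context {n : nat} (M : mesh R n) (Om : set 'rV[R]_n.+1).
Variable (C : ('rV[R]_n.+1 -> R) -> sobolev R n.+1).
Hypotheses (mOm : measurable Om) (C_lin : bounded_linear_to_P1_H10 M Om C).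
Variables (u : sobolev R n.+1) (uL : sobolev_L2 Om u).

Let C_L2 g : L2 Om g -> sobolev_L2 Om (C g).
Proof. by have [CH _ _] := C_lin; move=> /CH[/H10_sobolev_L2]. Qed.

(** [C] is linear up to [sob_eq], a relation that the Dirichlet form does not see. *)
Lemma dirichlet_averaging_lin c g g' : L2 Om g -> L2 Om g' ->
  dirichlet Om u (C (fun x => c * g x + g' x)) =
  c * dirichlet Om u (C g) + dirichlet Om u (C g').
Proof.
have [_ Cl _] := C_lin; move=> g2 g'2; rewrite -dirichlet_linr//;
  try exact: C_L2.
apply: eq_sob_dirichlet => //; last exact: Cl.
  by apply: C_L2; exact: L2_lin.
by apply: sobolev_L2_lin => //; exact: C_L2.
Qed.

(** Boundedness gives [C g] a zero gradient norm when g has zero L2 norm. *)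
Lemma dirichlet_averaging0 g : L2 Om g -> ae_on Om (fun x => g x = 0) ->
  dirichlet Om u (C g) = 0.
Proof.
have [_ _ [B CB]] := C_lin; move=> g2 g0.
apply: dirichlet_h1semi0 => //; first exact: C_L2.
have gg0 : l2dot Om g g = 0.
  rewrite (eq_ae_l2dot mOm g2 (L2_0 mOm) g2 g0) /l2dot.
  by under eq_Rintegral do rewrite mul0r; rewrite /Rintegral integral0.
apply/eqP; rewrite eq_le h1semi_ge0 andbT (le_trans (CB _ g2))//.
by rewrite /l2norm gg0 sqrtr0 mulr0.
Qed.

Lemma eq_ae_dirichlet_averaging g g' : L2 Om g -> L2 Om g' ->
  ae_on Om (fun x => g x = g' x) -> dirichlet Om u (C g) =
    dirichlet Om u (C g').
Proof.
move=> g2 g'2 gg'; have d2 := L2B mOm g2 g'2.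
have {1}-> : g = (fun x => 1 * (g x - g' x) + g' x).
  by apply/funext => x; rewrite mul1r subrK.
rewrite dirichlet_averaging_lin// dirichlet_averaging0 ?mulr0 ?add0r//.
by move: gg'; rewrite /ae_on; apply: filterS => x + Dx => /(_ Dx) ->;
  rewrite subrr.
Qed.

End averaging.

End broken.

(** * Error identity for the multiplier and its bound in the dual norm *)

Theorem theorem5p7 (R : realType) (n : nat)
  (dim23 : n.+1 = 2%N \/ n.+1 = 3%N)
  (* domain, load, obstacle and solution of the obstacle problem *)
  (Om : set 'rV[R]_n.+1)
  (Om_neq0 : Om !=set0) (Om_open : open Om) (Om_bounded : bounded_set Om)
  (Om_lipschitz : lipschitz_boundary Om)
  (f : 'rV[R]_n.+1 -> R) (f_L2 : L2 Om f)
  (phi : 'rV[R]_n.+1 -> R) (gphi : 'rV[R]_n.+1 -> 'rV[R]_n.+1)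
  (phi_H1 : H1 Om (phi, gphi))
  (phi_cont : {within closure Om, continuous phi})
  (phi_bdry : forall x, frontier Om x -> phi x <= 0)
  (u : sobolev R n.+1) (u_sol : obstacle_solution Om phi f u)
  (* Legendre function *)
  (Leg : 'rV[R]_n.+1 -> R -> \bar R)
  (Leg_legendre : legendre_integrand Om phi Leg)
  (Leg_conj : conjugate_facts Om phi Leg)
  (* mesh *)
  (M : mesh R n) (sigma : R) (M_triang : triangulation M Om sigma)
  (* abstract discretization *)
  (Vh : normedModType R) (Vh_fin : finite_dimensional Vh)
  (VT : set ('rV[R]_n.+1 -> R)) (VT_sub : subspace_of_functions VT)
  (P0_VT : pwpoly M Om 0 `<=` VT) (VT_P1 : VT `<=` pwpoly M Om 1)
  (p : Vh -> 'rV[R]_n.+1 -> R)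
  (p_VT : forall v, VT (p v))
  (p_linear : forall c v w,
     ae_on Om (fun x => p (c *: v + w) x = c * p v x + p w x))
  (Wh_p : forall w, pwpoly M Om 0 w ->
     exists v, ae_on Om (fun x => p v x = w x))
  (ah : Vh -> Vh -> R) (ah_bilin : symmetric_bilinear ah)
  (Ccoerc Ccont Cp CPi : R)
  (Ccoerc_gt0 : 0 < Ccoerc) (Ccont_gt0 : 0 < Ccont)
  (Cp_gt0 : 0 < Cp) (CPi_gt0 : 0 < CPi)
  (ah_coercive : forall v, Ccoerc * `|v| ^+ 2 <= ah v v)
  (ah_continuous : forall v z, ah v z <= Ccont * `|v| * `|z|)
  (p_bounded : forall v g, broken_H1 M Om (p v, g) ->
     dgnorm M (p v, g) <= Cp * `|v|)
  (Pi : sobolev R n.+1 -> Vh)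
  (Pi_linear : forall c v w, broken_H1 M Om v -> broken_H1 M Om w ->
     Pi (c *: v + w) = c *: Pi v + Pi w)
  (Pi_orth : forall v, broken_H1 M Om v -> forall w, pwpoly M Om 0 w ->
     l2dot Om (p (Pi v) - v.1) w = 0)
  (Pi_bounded : forall v, broken_H1 M Om v -> `|Pi v| <= CPi * dgnorm M v)
  (* iterates *)
  (alpha : nat -> R) (alpha_gt0 : forall k, (0 < k)%N -> 0 < alpha k)
  (alpha_div : \sum_(1 <= k < N) alpha k @[N --> \oo] --> +oo)
  (psi : nat -> 'rV[R]_n.+1 -> R) (psi_Wh : forall k, pwpoly M Om 0 (psi k))
  (uh : nat -> Vh)
  (iter_primal : forall k, (0 < k)%N -> forall v,
     ah (uh k) v + (alpha k)^-1 * l2dot Om (p v) (psi k - psi k.-1)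
     = l2dot Om f (p v))
  (iter_dual : forall k, (0 < k)%N -> forall w, pwpoly M Om 0 w ->
     l2dot Om (p (uh k)) w = l2dot Om (grad_conjugate Leg (psi k)) w)
  (* conforming averaging operator *)
  (Ch : ('rV[R]_n.+1 -> R) -> sobolev R n.+1)
  (Ch_linear : bounded_linear_to_P1_H10 M Om Ch) :
  let lambda := multiplier Om f u in
  let lambdah k x := (psi k.-1 x - psi k x) / alpha k in
  let Jh v := p (Pi v) in
  let delta vh := ah (Pi u) vh - dirichlet Om u (Ch (p vh)) in
  forall m, (0 < m)%N ->
  (hm1norm Om (fun v => l2dot Om (lambdah m) v.1 - lambda v)%R <=
     (CPi * Ccont * `|uh m - Pi u|)%:E
     + CPi%:E * dual_norm delta
     + ereal_sup [set (`|dirichlet Om u (v - Ch (Jh v))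
                         - l2dot Om f (v.1 - Jh v)| / h1semi Om v)%:E
                 | v in [set v | H10_nonzero Om v]])%E.
Proof.
move=> lambda lambdah Jh delta m m0.
have mOm := open_measurable_rV Om_open.
have uL := H10_sobolev_L2 u_sol.1.1.
have psi2 k : L2 Om (psi k) by exact: (psi_Wh k).1.
have p2 z : L2 Om (p z) by exact: (VT_P1 _ (p_VT z)).1.
have [CH _ _] := Ch_linear.
have p0 : ae_on Om (fun x => p 0 x = 0).
  have := p_linear 1 0 0; rewrite scale1r addr0 /ae_on.
  by apply: filterS => x + Dx => /(_ Dx); rewrite mul1r => /eqP;
    rewrite -subr_eq subrr => /eqP.
have pZ c z : ae_on Om (fun x => p (c *: z) x = c * p z x + 0).
  have := p_linear c z 0; rewrite addr0 /ae_on => pl.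
  apply: filterS2 pl p0 => x + + Dx => /(_ Dx) -> /(_ Dx) ->.
  by [].
have [ahl ahC] := ah_bilin.
have ah0 y : ah 0 y = 0.
  have := ahl 1 0 0 y; rewrite scale1r addr0 mul1r => /eqP.
  by rewrite -subr_eq subrr => /eqP.
have ahZr c y z : ah y (c *: z) = c * ah y z.
  by rewrite ahC -[c *: z]addr0 ahl ah0 addr0 ahC.
have ahBl x y z : ah (x - y) z = ah x z - ah y z.
  by rewrite addrC -scaleN1r ahl mulN1r addrC.
(* Homogeneity is what [le_dual_norm] asks of [delta]. As p (c z) and c p z agree only almost
   everywhere, it rests on the invariance of a(u, Ch g) under null changes of g. *)
have deltaZ c z : delta (c *: z) = c * delta z.
  rewrite /delta ahZr mulrBr; congr (_ - _).
  have z2 := L2_0 mOm.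
  rewrite (eq_ae_dirichlet_averaging mOm Ch_linear uL _ _ (pZ c z))//;
    last first.
    exact: L2_lin.
  rewrite (dirichlet_averaging_lin mOm Ch_linear uL)//.
  rewrite (dirichlet_averaging0 mOm Ch_linear uL z2) ?addr0//.
  by rewrite /ae_on; exact: aeW.
apply: ge_ereal_sup => _ [v [vH v0] <-].
have vL := H10_sobolev_L2 vH; have bv := H10_broken_H1 M_triang Om_open vH.
have dgv := dgnorm_le_h1semi M_triang Om_open Om_bounded vH.
set z := Pi v; set S := h1semi Om v.
have S0 : 0 <= S by exact: h1semi_ge0.
have SV0 : 0 <= S^-1 by rewrite invr_ge0.
have zS : `|z| <= CPi * S.
  by apply: (le_trans (Pi_bounded _ bv)); rewrite ler_wpM2l// ltW.
pose r := S^-1 * `|z|.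
(* If the gradient norm S is 0, then S^-1 = 0 by convention and r = 0. *)
have rC : r <= CPi.
  have [S00|Sn0] := eqVneq S 0; first by rewrite /r S00 invr0 mul0r ltW.
  by rewrite /r mulrC ler_pdivrMr// lt_def Sn0.
have r0 : 0 <= r by rewrite mulr_ge0.
pose N3 := dirichlet Om u (v - Ch (Jh v)) - l2dot Om f (v.1 - Jh v).
(* Each psi k is piecewise constant, so v may be replaced by its image under [Jh] in the pairing
   with the discrete multiplier. *)
have ortho k : l2dot Om (psi k) v.1 = l2dot Om (psi k) (p z).
  have := Pi_orth _ bv _ (psi_Wh k).
  rewrite -[LHS]/(l2dot Om (fun x => p z x - v.1 x) (psi k)).
  rewrite l2dotBl//; last exact: vL.1.
  by rewrite !(l2dotC Om (psi k)) => /eqP; rewrite subr_eq0 => /eqP.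
have lamE w : L2 Om w -> l2dot Om (lambdah m) w =
    - ((alpha m)^-1 * (l2dot Om (psi m) w - l2dot Om (psi m.-1) w)).
  move=> w2; rewrite -l2dotBl// -mulrN.
  have d2 := L2B mOm (psi2 m.-1) (psi2 m).
  have := l2dot_linl (alpha m)^-1 mOm d2 (L2_0 mOm) w2.
  rewrite [X in _ = _ + X -> _](_ : _ = 0); last first.
    by rewrite /l2dot /Rintegral; under eq_integral do rewrite mul0r;
      rewrite integral0.
  rewrite addr0 !l2dotBl// opprB => <-; congr l2dot; apply/funext => x.
  by rewrite /lambdah addr0 mulrC.
have NE : l2dot Om (lambdah m) v.1 - lambda v =
  ah (uh m - Pi u) z + delta z - N3.
  (* Testing with z = Pi v trades (f, p z) for a_h(u_h^m, z) and the increment of psi; the terms in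
     [Pi u] and [Ch (p z)] are inserted and cancel. *)
  have := iter_primal m m0 z.
  rewrite (l2dotC Om (p z))
    -[l2dot Om (psi m - psi m.-1) _]/(l2dot Om
      (fun x => psi m x - psi m.-1 x) (p z)).
  rewrite l2dotBl// => it.
  rewrite lamE; last exact: vL.1.
  rewrite !ortho /N3 /lambda /multiplier /delta ahBl.
  have CL := H10_sobolev_L2 (CH _ (p2 z)).1.
  rewrite dirichletBr//
    -[l2dot Om f (v.1 - Jh v)]/(l2dot Om f (fun x => v.1 x - p z x)).
  rewrite (l2dotC Om f (fun x => v.1 x - p z x)) l2dotBl//; last exact: vL.1.
  rewrite (l2dotC Om (p z) f) (l2dotC Om v.1 f) -it.
  rewrite /Jh -/z; ring.
have bound : (l2dot Om (lambdah m) v.1 - lambda v) / S <=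
    CPi * Ccont * `|uh m - Pi u| + S^-1 * `|delta z| + `|N3| / S.
  have h1 := ah_continuous (uh m - Pi u) z.
  have h2 := ler_norm (delta z); have h3 := ler_norm (- N3).
  rewrite normrN in h3.
  apply: (@le_trans _ _
    (S^-1 * (Ccont * `|uh m - Pi u| * `|z| + `|delta z| + `|N3|))).
    rewrite mulrC NE ler_wpM2l//; lra.
  rewrite !mulrDr (mulrC _ S^-1) !lerD2r mulrCA -/r -mulrA mulrC ler_wpM2r//.
  by rewrite mulr_ge0// ltW.
have d0 := dual_norm_ge0 delta.
(* The bound is a real one so far; the two possibly infinite suprema enter only now. *)
apply: (@le_trans _ _
  ((CPi * Ccont * `|uh m - Pi u| + S^-1 * `|delta z| + `|N3| / S)%:E)).
  by rewrite lee_fin.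
rewrite !EFinD; apply: leeD; [apply: leeD => //|].
  rewrite EFinM;
    apply: (@le_trans _ _ (S^-1%:E * (`|z|%:E * dual_norm delta))%E).
    by apply: lee_wpmul2l; [rewrite lee_fin|exact: le_dual_norm].
  rewrite muleA -EFinM; apply: lee_wpmul2r => //.
by apply: ereal_sup_ubound; exists v.
Qed.
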